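(* Let $H\in(1/2,1)$, $T>0$, $r>0$, let $\sigma,b\in\mathcal{C}^\infty_b(\mathbb{R})$ and $\eta\in\mathcal{C}^\infty_b((-r,0))$, and suppose there exist two constants $0<\lambda<\Lambda$ such that $\lambda\le\sigma(y)\le\Lambda$ for all $y\in\mathbb{R}$. Let $X$ be the solution of $$X_t=\eta_0+\int_0^t\sigma(X_{s-r})\,dB^H_s+\int_0^t b(X_s)\,ds,\quad t\in(0,T],\qquad X_t=\eta_t,\quad t\in[-r,0].$$ Then, for every $t\in(0,T]$, the density $p_t$ of $X_t$ is strictly positive in its support.
   Context: $B^H=\{B^H_t;t\in[0,T]\}$ is a one-dimensional fractional Brownian motion with Hurst parameter $H>1/2$, i.e. a centered Gaussian process with covariance $R_H(t,s)=\frac12(t^{2H}+s^{2H}-|t-s|^{2H})$, realized as the canonical process on $\Omega=\mathcal{C}_0([0,T])$. The integral with respect to $B^H$ is a pathwise Young (Riemann–Stieltjes) integral. $\mathcal{C}^\infty_b$ denotes smooth functions that are bounded together with all their derivatives; the deterministic initial condition $\eta$ is a smooth function on $[-r,0]$. The equation has a unique solution, and for each $t\in(0,T]$ the random variable $X_t$ has a smooth density; $p_t$ denotes this smooth version. *)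

(* Defs.v *)
From HB Require Import structures.
From mathcomp Require Import all_boot all_order all_algebra.
From mathcomp Require Import all_classical all_reals all_analysis.

Set Implicit Arguments.
Unset Strict Implicit.
Unset Printing Implicit Defensive.

Import Order.TTheory GRing.Theory Num.Theory.
Import numFieldNormedType.Exports.

Local Open Scope classical_set_scope.
Local Open Scope ring_scope.

(* The library's iterated derivative derive1n is local, so on an open set D these
   two notions only depend on the restriction of f to D. *)
Definition smooth_on (R : realType) (D : set R) (f : R -> R) : Prop :=
  forall (n : nat) (x : R), D x -> derivable (derive1n n f) x 1.

Definition smooth_bounded_on (R : realType) (D : set R) (f : R -> R) : Prop :=
  smooth_on D f /\
  forall n : nat, exists M : R, forall x : R, D x -> `|derive1n n f x| <= M.

(* Limit of the Riemann-Stieltjes sums over tagged partitions as the mesh tends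
   to 0.  When f and g are Hoelder continuous with exponents of sum > 1 this
   limit exists and is the Young integral of f against g. *)
Definition is_young_integral (R : realType) (f g : R -> R) (a b l : R) : Prop :=
  forall eps : R, 0 < eps -> exists2 delta : R, 0 < delta &
    forall (n : nat) (s xi : nat -> R), s 0%N = a -> s n = b ->
      (forall i : nat, (i < n)%N ->
         s i <= xi i <= s i.+1 /\ s i.+1 - s i < delta) ->
      `|\sum_(i < n) f (xi i) * (g (s i.+1) - g (s i)) - l| < eps.

(* A path in C_0([0,T]) is represented by its extension by 0 to the whole real
   line, so that equality of representatives is equality of paths on [0,T]. *)
Definition C0_set (R : realType) (T : R) : set (R -> R) :=
  [set w | [/\ {within `[0, T], continuous w}, w 0 = 0 &
              forall t : R, t \notin `[0, T] -> w t = 0]].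

Definition C0 (R : realType) (T : R) : Type := set_type (C0_set T).

Lemma C0_set0 (R : realType) (T : R) : (fun=> 0 : R) \in C0_set T.
Proof. by apply/mem_set; split => //; by apply: continuous_subspaceT => x; exact: cvg_cst. Qed.

HB.instance Definition _ (R : realType) (T : R) :=
  Choice.copy (C0 T) (set_type (C0_set T)).
HB.instance Definition _ (R : realType) (T : R) :=
  isPointed.Build (C0 T) (exist _ (fun=> 0) (C0_set0 T)).

Definition cylinder (R : realType) (T : R) : set (set (C0 T)) :=
  [set A | exists2 t : R, t \in `[0, T] &
     exists2 E : set R, measurable E & A = [set w : C0 T | E (val w t)]].

(* C_0([0,T]) with the sigma-algebra generated by the coordinates, which is the
   Borel sigma-algebra of the uniform norm. *)
Definition path_space (R : realType) (T : R) := g_sigma_algebraType (@cylinder R T).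

Definition canonical_process (R : realType) (T : R) (t : R) (w : path_space T) : R :=
  (val : C0 T -> R -> R) w t.

(* In the library normal_prob m 0 is not the Dirac mass at m, hence the case
   distinction for degenerate Gaussian laws. *)
Definition is_gaussian d (Omega : measurableType d) (R : realType)
    (P : probability Omega R) (Y : Omega -> R) : Prop :=
  measurable_fun setT Y /\
  exists m s : R, 0 <= s /\
    forall A : set R, measurable A ->
      P (Y @^-1` A) = if s == 0 then \d_m A else normal_prob m s A.

Definition is_gaussian_process d (Omega : measurableType d) (R : realType)
    (P : probability Omega R) (I : set R) (B : R -> Omega -> R) : Prop :=
  forall (n : nat) (t a : 'I_n -> R), (forall i, I (t i)) ->
    is_gaussian P (fun w => \sum_(i < n) a i * B (t i) w).

Definition fbm_cov (R : realType) (H t s : R) : R :=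
  2^-1 * (t `^ (2 * H) + s `^ (2 * H) - `|t - s| `^ (2 * H)).

Definition is_fbm d (Omega : measurableType d) (R : realType)
    (P : probability Omega R) (H T : R) (B : R -> Omega -> R) : Prop :=
  [/\ is_gaussian_process P `[0, T] B,
      forall t : R, t \in `[0, T] -> ('E_P[B t] = 0)%E &
      forall t s : R, t \in `[0, T] -> s \in `[0, T] ->
        covariance P (B t) (B s) = (fbm_cov H t s)%:E].

(* x is a continuous path on [-r,T] solving the delay equation driven by w. *)
Definition delay_solution (R : realType) (r T : R) (sigma b eta w x : R -> R)
    : Prop :=
  [/\ {within `[- r, T], continuous x},
      forall t : R, t \in `[- r, 0] -> x t = eta t &
      forall t : R, t \in `]0, T] ->
        exists2 I : R, is_young_integral (fun s => sigma (x (s - r))) w 0 t I &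
          x t = eta 0 + I + \int[lebesgue_measure]_(s in `[0, t]) b (x s)].

Definition is_smooth_density d (Omega : measurableType d) (R : realType)
    (P : probability Omega R) (Y : {RV P >-> R}) (p : R -> R) : Prop :=
  [/\ smooth_on setT p, forall x : R, 0 <= p x &
      forall A : set R, measurable A ->
        distribution P Y A = (\int[lebesgue_measure]_(x in A) (p x)%:E)%E].

Definition closed_support (R : realType) (p : R -> R) : set R :=
  closure [set x | p x != 0].

(* Main.v *)
(* With a = max 0 (t - r), take a nondecreasing h in the reproducing kernel
   Hilbert space of the fractional Brownian motion with h = 0 on [0, a] and
   h t > 0.  Let N be the standard Gaussian variable representing h, so that
   W - N k h is independent of N for a suitable constant k > 0.  Replacing N by
   an independent standard Gaussian zeta,
     Phi (w, zeta) = w + (zeta - N w) k h,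
   preserves the law of W.  For fixed w, the coefficient sigma (X_(s-r)) is, up
   to time t, a functional of the path before a, hence does not depend on zeta;
   as sigma >= lam > 0 and b is bounded and Lipschitz, zeta |-> X_t (Phi (w, zeta))
   is Lipschitz with an increment at least c1 (zeta' - zeta) - c3.  It therefore
   takes values close to any x near some zeta, so that
   P (|X_t - x| < e) >= c e for small e and some c > 0.  As p_t is continuous,
   p_t x > 0; this holds for every real x. *)
From HB Require Import structures.
Require Import Defs.
From mathcomp Require Import all_boot all_order all_algebra.
From mathcomp Require Import all_classical all_reals all_analysis.
From mathcomp Require Import measurable_realfun ring lra.
Import Order.TTheory GRing.Theory Num.Theory.
Import numFieldNormedType.Exports.
Local Open Scope classical_set_scope.
Local Open Scope ring_scope.

Set Implicit Arguments.
Unset Strict Implicit.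
Unset Printing Implicit Defensive.

(** * Comparison of two solutions of the delay equation *)

(** The main obstacle is that everything known about the solution holds off a null set. For fixed w
    the estimates on zeta |-> X_t (Phi (w, zeta)) are available only for zeta in a set of full
    Gaussian measure, hence dense, and the place where a target x is approached depends on w. The
    hitting argument therefore runs on a dense set, and uniformity in w comes from an event of
    positive probability on which zeta and X_t are bounded by some n. As Phi preserves the law, the
    exceptional set pulls back to a null set. The function h is the image of the indicator of [a, T]
    under the Mandelbrot-Van Ness representation: its kernel (s - u)_+^(H - 1/2) vanishes for s <= a
    <= u and increases with s because H > 1/2. The variable N comes from minimizing |c|^2 - 2 h(c)
    over finite combinations c of coordinates. Invariance of the law is checked on cosine
    transforms: projecting N out of a combination lowers its variance by exactly what the
    independent term restores. *)

Section within.
Context {R : realType} {T : topologicalType}.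

Lemma within_continuousM (A : set T) (f g : T -> R) :
  {within A, continuous f} -> {within A, continuous g} ->
  {within A, continuous (fun x => f x * g x)}.
Proof. by move=> cf cg x; apply: cvgM; [exact: cf|exact: cg]. Qed.

Lemma within_continuous_compT (U : topologicalType) (A : set T)
    (f : T -> U) (g : U -> R) :
  {within A, continuous f} -> continuous g ->
  {within A, continuous (fun x => g (f x))}.
Proof.
move=> cf cg x; apply: (@continuous_comp (subspace A) U R f g); first exact: cf.
exact: cg.
Qed.

End within.

Section young.
Context {R : realType}.
Implicit Types (a b : R) (f g w h : R -> R).

Definition partition (a b : R) (n : nat) (s : nat -> R) :=
  [/\ s 0%N = a, s n = b & forall i, (i < n)%N -> s i <= s i.+1].

Lemma partition_itv a b n s i : partition a b n s -> (i <= n)%N ->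
  a <= s i <= b.
Proof.
case=> s0 sn sS; have mono j k : (j + k <= n)%N -> s j <= s (j + k)%N.
  elim: k => [|k IH]; first by rewrite addn0.
  by rewrite addnS => jk; rewrite (le_trans (IH (ltnW jk)))// sS.
move=> i_n; rewrite -s0 -sn; apply/andP; split.
  by rewrite -[i]add0n mono// add0n.
by have := mono i (n - i)%N; rewrite subnKC//; apply.
Qed.

Lemma uniform_partition a b delta : a <= b -> 0 < delta ->
  exists n s, partition a b n s /\ forall i, (i < n)%N -> s i.+1 - s i < delta.
Proof.
move=> ab d0.
set n := (Num.truncn ((b - a) / delta)).+1.
have n0 : 0 < n%:R :> R by rewrite ltr0n.
have step : (b - a) / n%:R < delta.
  by rewrite ltr_pdivrMr// mulrC -ltr_pdivrMr// Num.Theory.truncnS_gt.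
exists n, (fun i => a + (b - a) * i%:R / n%:R).
have stepE i : a + (b - a) * i.+1%:R / n%:R - (a + (b - a) * i%:R / n%:R) =
    (b - a) / n%:R.
  by rewrite -natr1; field; rewrite gt_eqF.
split; last by move=> i _; rewrite stepE.
split; first by rewrite mulr0 mul0r addr0.
  by rewrite mulfK ?gt_eqF// addrC subrK.
by move=> i _; rewrite -subr_ge0 stepE divr_ge0// ?subr_ge0// ltW.
Qed.

(** Both integrals are read off one common partition with left-endpoint tags, so that the two sums
    can be subtracted term by term. *)
Lemma young_sums f1 g1 f2 g2 a b I1 I2 eps : a <= b -> 0 < eps ->
  is_young_integral f1 g1 a b I1 -> is_young_integral f2 g2 a b I2 ->
  exists n s, [/\ partition a b n s,
    `|\sum_(i < n) f1 (s i) * (g1 (s i.+1) - g1 (s i)) - I1| < eps &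
    `|\sum_(i < n) f2 (s i) * (g2 (s i.+1) - g2 (s i)) - I2| < eps].
Proof.
move=> ab eps0 /(_ _ eps0)[d1 d10 Y1] /(_ _ eps0)[d2 d20 Y2].
have d0 : 0 < Num.min d1 d2 by rewrite lt_min d10.
have [n [s [sP sd]]] := uniform_partition ab d0; exists n, s.
have [s0 sn sS] := sP; split => //.
  apply: Y1 => // i i_n; rewrite lexx sS//; split => //.
  by rewrite (lt_le_trans (sd _ i_n))// ge_min lexx.
apply: Y2 => // i i_n; rewrite lexx sS//; split => //.
by rewrite (lt_le_trans (sd _ i_n))// ge_min lexx orbT.
Qed.

(** On a common partition the two Riemann sums differ by the sum of [f1 (s i) * dz] times the
    increments of h. These increments are nonnegative, so the bounds on f1 pass through the sum, and
    the increments telescope. *)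
Lemma young_integral_shift f1 f2 w1 w2 h a b I1 I2 lam Lam dz : a <= b ->
  is_young_integral f1 w1 a b I1 -> is_young_integral f2 w2 a b I2 ->
  (forall s, a <= s <= b -> f1 s = f2 s) ->
  (forall s, a <= s <= b -> lam <= f1 s <= Lam) ->
  (forall s, a <= s <= b -> w2 s = w1 s + dz * h s) ->
  (forall s s', a <= s -> s <= s' -> s' <= b -> h s <= h s') -> 0 <= dz ->
  lam * dz * (h b - h a) <= I2 - I1 <= Lam * dz * (h b - h a).
Proof.
move=> ab Y1 Y2 fE fb wE hm dz0.
suff H eps : 0 < eps -> lam * dz * (h b - h a) <= I2 - I1 + eps /\
                       I2 - I1 <= Lam * dz * (h b - h a) + eps.
  apply/andP; split; apply/ler_addgt0Pr => e e0; have [] := H e e0 => //.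
move=> e0; have e20 : 0 < eps / 2 by lra.
have [n [s [sP S1 S2]]] := young_sums ab e20 Y1 Y2.
have [s0 sn sS] := sP.
set A1 := \sum_(i < n) _ in S1; set A2 := \sum_(i < n) _ in S2.
have tel : h b - h a = \sum_(i < n) (h (s i.+1) - h (s i)).
  by rewrite -s0 -sn -(@telescope_sumr _ 0 n (h \o s))// big_mkord.
have AE : A2 - A1 = \sum_(i < n) f1 (s i) * dz * (h (s i.+1) - h (s i)).
  rewrite /A1 /A2 -sumrB; apply: eq_bigr => i _.
  have ii := partition_itv sP (ltnW (ltn_ord i)).
  have iS := partition_itv sP (ltn_ord i).
  by rewrite -fE// !wE//; ring.
have hS (i : 'I_n) : 0 <= h (s i.+1) - h (s i).
  rewrite subr_ge0; apply: hm; last 2 first.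
  - exact: sS.
  - by have /andP[] := partition_itv sP (ltn_ord i).
  - by have /andP[] := partition_itv sP (ltnW (ltn_ord i)).
have lo : lam * dz * (h b - h a) <= A2 - A1.
  rewrite tel AE mulr_sumr; apply: ler_sum => i _.
  have /andP[l1 l2] := fb _ (partition_itv sP (ltnW (ltn_ord i))).
  by rewrite ler_wpM2r// ler_wpM2r.
have up : A2 - A1 <= Lam * dz * (h b - h a).
  rewrite tel AE mulr_sumr; apply: ler_sum => i _.
  have /andP[l1 l2] := fb _ (partition_itv sP (ltnW (ltn_ord i))).
  by rewrite ler_wpM2r// ler_wpM2r.
move: S1 S2; rewrite !ltr_norml => /andP[? ?] /andP[? ?]; split; lra.
Qed.

End young.

Section gronwall.
Context {R : realType}.
Notation mu := (@lebesgue_measure R).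

Lemma integral_expR_itv (c s : R) : 0 < c -> 0 <= s ->
  \int[mu]_(u in `[0, s]) expR (c * u) = (expR (c * s) - 1) / c.
Proof.
move=> c0; rewrite le_eqVlt => /predU1P[<-|s0].
  by rewrite set_itv1 Rintegral_set1 mulr0 expR0 subrr mul0r.
have dE (x : R) : is_derive x 1 (fun u => expR (c * u) / c) (expR (c * x)).
  have dM : is_derive x 1 ( *%R c) c.
    by apply: is_derive_eq; rewrite /GRing.scale/= mulr1.
  have dM' := is_derive1_comp (is_derive_expR (c * x)) dM.
  rewrite (_ : (fun u => _) = c^-1 \*: (expR \o ( *%R c))); last first.
    by apply/funext => u /=; rewrite mulrC.
  apply: is_derive_eq; rewrite /GRing.scale/=.
  by rewrite mulrC mulfK// gt_eqF.
rewrite /Rintegral (@continuous_FTC2 _ _ (fun u => expR (c * u) / c))//=.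
- by rewrite mulr0 expR0 -mulrBl.
- apply: continuous_subspaceT => x.
  apply: (continuous_comp (f := *%R c)); first exact: mulrl_continuous.
  exact: continuous_expR.
- have cE : continuous (fun u : R => expR (c * u) / c).
    move=> x; apply: differentiable_continuous.
    by apply/derivable1_diffP; apply: ex_derive.
  split => //.
  + by apply: cvg_at_right_filter; exact: cE.
  + by apply: cvg_at_left_filter; exact: cE.
- by move=> x _; rewrite derive1E; apply: derive_val.
Qed.

(** Weighted sup-norm argument: at a maximum point m of [E], integrating the weight produces the
    factor 1/(2 beta), so that at most half of [E m * expR (2 * beta * m)] reappears on the right
    and can be absorbed. *)
Lemma gronwall (D : R -> R) (A beta t : R) : 0 <= t -> 0 < beta ->
  {within `[0, t], continuous D} ->
  (forall s, 0 <= s <= t ->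
    `|D s| <= A + beta * \int[mu]_(u in `[0, s]) `|D u|) ->
  forall s, 0 <= s <= t -> `|D s| <= 2 * A * expR (2 * beta * t).
Proof.
move=> t0 b0 cD hD.
pose E s := `|D s| * expR (- (2 * beta * s)).
have cexp (c : R) : continuous (fun s : R => expR (c * s)).
  move=> x; apply: (continuous_comp (f := *%R c)); first exact: mulrl_continuous.
  exact: continuous_expR.
have cE : {within `[0, t], continuous E}.
  apply: within_continuousM.
    by apply: within_continuous_compT cD _; exact: norm_continuous.
  apply: continuous_subspaceT.
  rewrite (_ : (fun x => _) = (fun s => expR (- (2 * beta) * s))); first exact: cexp.
  by apply/funext => s; rewrite mulNr.
have DE s : `|D s| = E s * expR (2 * beta * s).
  by rewrite /E -mulrA -expRD addNr expR0 mulr1.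
have [m m0t mE] := EVT_max t0 cE.
move: m0t; rewrite in_itv/= => /andP[m0 mt].
have le_int : \int[mu]_(u in `[0, m]) `|D u| <=
    \int[mu]_(u in `[0, m]) (E m * expR (2 * beta * u)).
  have sub : (`[0, m]%classic : set R) `<=` `[0, t]%classic.
    by apply: subset_itvl; rewrite bnd_simp.
  apply: le_Rintegral => //.
  - apply: continuous_compact_integrable; first exact: segment_compact.
    apply: continuous_subspaceW sub _.
    by apply: within_continuous_compT cD _; exact: norm_continuous.
  - apply: continuous_compact_integrable; first exact: segment_compact.
    by apply: continuous_subspaceT => y; apply: cvgM; [exact: cvg_cst|exact: cexp].
  - move=> u /=; rewrite in_itv/= => /andP[u0 um].
    rewrite DE ler_wpM2r ?expR_ge0//; apply: mE.
    by rewrite in_itv/= u0 (le_trans um).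
have := hD m; rewrite m0 mt => /(_ isT) Dm.
rewrite RintegralZl// in le_int; last first.
  apply: continuous_compact_integrable; first exact: segment_compact.
  exact: continuous_subspaceT.
rewrite integral_expR_itv ?mulr_gt0// in le_int.
have Em0 : 0 <= E m by rewrite mulr_ge0// expR_ge0.
have e1 : 1 <= expR (2 * beta * m) by rewrite -expR0 ler_expR !mulr_ge0// ltW.
have A0 : 0 <= A.
  have := hD 0; rewrite lexx t0 => /(_ isT).
  by rewrite set_itv1 Rintegral_set1 mulr0 addr0; apply: le_trans.
have key : E m * expR (2 * beta * m) <= A + E m * (expR (2 * beta * m) - 1) / 2.
  rewrite -DE (le_trans Dm)// lerD2l.
  rewrite (_ : _ / 2 = beta * (E m * ((expR (2 * beta * m) - 1) / (2 * beta)))).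
    by rewrite ler_pM2l.
  by field; rewrite gt_eqF.
have Em2 : E m <= 2 * A by nra.
move=> s s0t; have /andP[s0 st] := s0t.
have Es : E s <= 2 * A by rewrite (le_trans _ Em2)// mE// in_itv/=.
rewrite DE.
apply: ler_pM => //; rewrite ?expR_ge0 ?mulr_ge0 ?expR_ge0//.
by rewrite ler_expR ler_pM2l//; lra.
Qed.

End gronwall.

Section delay.
Context {R : realType}.
Notation mu := (@lebesgue_measure R).
Variables (r T : R) (sigma b eta : R -> R) (lam Lam B beta : R).
Hypothesis r0 : 0 < r.
Hypothesis sigma_bounds : forall y, lam <= sigma y <= Lam.
Hypothesis lam0 : 0 <= lam.
Hypothesis b_bound : forall y, `|b y| <= B.
Hypothesis b_lip : forall x y, `|b x - b y| <= beta * `|x - y|.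
Hypothesis beta0 : 0 < beta.
Hypothesis b_cont : continuous b.

Variables (w1 w2 x1 x2 h : R -> R) (dz : R).
Hypothesis X1 : delay_solution r T sigma b eta w1 x1.
Hypothesis X2 : delay_solution r T sigma b eta w2 x2.
Hypothesis dz0 : 0 <= dz.
Hypothesis wE : forall u, 0 <= u <= T -> w2 u = w1 u + dz * h u.
Hypothesis h0 : h 0 = 0.

Let r0' : 0 <= r := ltW r0.

Let Lam0 : 0 <= Lam.
Proof. by have /andP[l1 l2] := sigma_bounds 0; exact: le_trans (le_trans lam0 l1) l2. Qed.

Let cb x w : delay_solution r T sigma b eta w x -> forall s, 0 <= s <= T ->
  {within `[0, s], continuous (fun u => b (x u))}.
Proof.
case=> cx _ _ s /andP[s0 sT]; apply: within_continuous_compT b_cont.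
apply: continuous_subspaceW cx.
by apply: subset_itv; rewrite bnd_simp// oppr_le0.
Qed.

Let ib x w : delay_solution r T sigma b eta w x -> forall s, 0 <= s <= T ->
  mu.-integrable `[0, s] (EFin \o (fun u => b (x u))).
Proof.
move=> X s s0T; apply: continuous_compact_integrable; first exact: segment_compact.
exact: cb X _ s0T.
Qed.

Let cD s : 0 <= s <= T -> {within `[0, s], continuous (fun u => x2 u - x1 u)}.
Proof.
case/andP=> s0 sT; have [c1 _ _] := X1; have [c2 _ _] := X2.
apply: (@within_continuousB _ _ _ _ x2 x1).
  by apply: continuous_subspaceW c2; apply: subset_itv; rewrite bnd_simp// oppr_le0.
by apply: continuous_subspaceW c1; apply: subset_itv; rewrite bnd_simp// oppr_le0.
Qed.

(** Equal delayed arguments make the two Young integrals share their integrand, so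
    [young_integral_shift] applies. The drift is treated in two ways: its Lipschitz bound and
    Gronwall give the first estimate, while its boundedness gives the second, which keeps the slope
    [lam] in dz at the price of an additive constant. *)
Lemma delay_gap tau : 0 <= tau <= T ->
  (forall u, 0 <= u <= tau -> x1 (u - r) = x2 (u - r)) ->
  (forall s s', 0 <= s -> s <= s' -> s' <= tau -> h s <= h s') ->
  forall s, 0 <= s <= tau ->
  `|x2 s - x1 s| <= 2 * (Lam * dz * h tau) * expR (2 * beta * tau) /\
  lam * dz * h s - 2 * B * s <= x2 s - x1 s.
Proof.
move=> /andP[tau0 tauT] xE hm.
have h_ge0 s : 0 <= s <= tau -> 0 <= h s.
  by case/andP=> s0 st; rewrite -h0; apply: hm.
have key s : 0 <= s <= tau -> exists2 J, lam * dz * h s <= J <= Lam * dz * h s &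
    x2 s - x1 s = J + \int[mu]_(u in `[0, s]) (b (x2 u) - b (x1 u)).
  (* The integral equation is stated for positive times only; at time 0 both solutions equal
     [eta 0]. *)
  case/andP; rewrite le_eqVlt => /predU1P[<- _|s0 st].
    exists 0; first by rewrite h0 !mulr0 lexx.
    rewrite set_itv1 Rintegral_set1 addr0.
    have [_ e1 _] := X1; have [_ e2 _] := X2.
    by rewrite e1 ?e2 ?subrr// in_itv/= lexx oppr_le0 r0'.
  have s0T : 0 <= s <= T by rewrite (ltW s0)/= (le_trans st).
  have sI : s \in `]0, T] by rewrite in_itv/= s0 (le_trans st).
  have [_ _ /(_ s sI)[I1 Y1 xs1]] := X1; have [_ _ /(_ s sI)[I2 Y2 xs2]] := X2.
  exists (I2 - I1).
    rewrite -[h s]subr0 -h0; apply: (young_integral_shift (ltW s0) Y1 Y2) => //.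
    - by move=> u /andP[u0 us]; rewrite xE// u0 (le_trans us).
    - by move=> u /andP[u0 us]; rewrite wE// u0 (le_trans us)// (le_trans st).
    - by move=> u u' u0 uu' us; apply: hm => //; rewrite (le_trans us).
  rewrite RintegralB//; [|exact: ib X2 _ s0T|exact: ib X1 _ s0T].
  by rewrite xs1 xs2; ring.
have iN s : 0 <= s <= tau -> mu.-integrable `[0, s]
    (EFin \o (fun u => `|b (x2 u) - b (x1 u)|)).
  case/andP=> s0 st; have s0T : 0 <= s <= T by rewrite s0 (le_trans st).
  apply: continuous_compact_integrable; first exact: segment_compact.
  apply: within_continuous_compT; last exact: norm_continuous.
  by apply: (@within_continuousB _ _ _ _ (fun u => b (x2 u)) (fun u => b (x1 u)));
    [exact: cb X2 _ s0T|exact: cb X1 _ s0T].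
have iB s : 0 <= s <= tau -> mu.-integrable `[0, s]
    (EFin \o (fun u => b (x2 u) - b (x1 u))).
  case/andP=> s0 st; have s0T : 0 <= s <= T by rewrite s0 (le_trans st).
  apply: continuous_compact_integrable; first exact: segment_compact.
  by apply: (@within_continuousB _ _ _ _ (fun u => b (x2 u)) (fun u => b (x1 u)));
    [exact: cb X2 _ s0T|exact: cb X1 _ s0T].
have iD s : 0 <= s <= tau -> mu.-integrable `[0, s]
    (EFin \o (fun u => `|x2 u - x1 u|)).
  case/andP=> s0 st; have s0T : 0 <= s <= T by rewrite s0 (le_trans st).
  apply: continuous_compact_integrable; first exact: segment_compact.
  apply: within_continuous_compT; last exact: norm_continuous.
  exact: cD.
have up s : 0 <= s <= tau ->
    `|x2 s - x1 s| <= Lam * dz * h tau + beta * \int[mu]_(u in `[0, s]) `|x2 u - x1 u|.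
  move=> s0t; have [J /andP[J1 J2] ->] := key s s0t.
  have J0 : 0 <= J.
    by apply: le_trans J1; rewrite !mulr_ge0// h_ge0.
  rewrite (le_trans (ler_normD _ _))// lerD//.
    rewrite ger0_norm// (le_trans J2)//.
    apply: ler_wpM2l; first exact: mulr_ge0.
    by case/andP: s0t => s0 st; apply: hm.
  rewrite (le_trans (le_normr_Rintegral _ _))//; first exact: iB.
  rewrite -RintegralZl//; last exact: iD.
  apply: le_Rintegral => //; first exact: iN.
  have s0T : 0 <= s <= T by case/andP: s0t => -> st; rewrite (le_trans st).
  apply: continuous_compact_integrable; first exact: segment_compact.
  apply: within_continuousM; first by apply: continuous_subspaceT => x; exact: cvg_cst.
  by apply: within_continuous_compT (cD s0T) _; exact: norm_continuous.
move=> s s0t; split.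
  apply: (gronwall tau0 beta0 _ up) => //.
  by apply: cD; rewrite tau0.
have [J /andP[J1 J2] ->] := key s s0t.
rewrite lerD//.
have s0 : 0 <= s by case/andP: s0t.
rewrite lerNl (le_trans (ler_norm _))// normrN.
rewrite (le_trans (le_normr_Rintegral _ _))//; first exact: iB.
rewrite (_ : 2 * B * s = \int[mu]_(u in `[0, s]) (2 * B)).
  apply: le_Rintegral => //; first exact: iN.
    apply: continuous_compact_integrable; first exact: segment_compact.
    by apply: continuous_subspaceT => x; exact: cvg_cst.
  move=> u _; rewrite (le_trans (ler_normB _ _))//.
  by have := b_bound (x2 u); have := b_bound (x1 u); lra.
rewrite Rintegral_cst//= lebesgue_measure_itv/= lte_fin.
by move: s0; rewrite le_eqVlt => /predU1P[<-|->]; rewrite ?ltxx//= oppr0 addr0.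
Qed.

(* Up to time t the delayed argument stays below a, where h vanishes and the two
   solutions agree. *)
Lemma delay_flow a t : 0 <= t <= T -> 0 <= a -> a <= t -> t - r <= a ->
  (forall s, 0 <= s <= a -> h s = 0) ->
  (forall s s', 0 <= s -> s <= s' -> s' <= t -> h s <= h s') ->
  `|x2 t - x1 t| <= 2 * (Lam * dz * h t) * expR (2 * beta * t) /\
  lam * dz * h t - 2 * B * t <= x2 t - x1 t.
Proof.
move=> /andP[t0 tT] a0 a_t tra ha hm.
(* Method of steps: agreement up to k r makes the delayed arguments agree up to (k + 1) r, and the
   upper bound of [delay_gap] is zero there because h vanishes on [0, a]. *)
have past k s : - r <= s -> s <= a -> s <= k%:R * r -> x1 s = x2 s.
  elim: k s => [|k IH] s rs sa sk.
    have [_ e1 _] := X1; have [_ e2 _] := X2.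
    by rewrite e1 ?e2// in_itv/= rs; rewrite mul0r in sk.
  have [s0|s0] := leP s 0; first by apply: IH => //; rewrite (le_trans s0)// mulr_ge0.
  have s0' := ltW s0.
  have sT : s <= T by rewrite (le_trans sa)// (le_trans a_t).
  have [] := @delay_gap s _ _ _ s.
  - by rewrite s0' sT.
  - move=> u /andP[u0 us]; apply: IH.
    + by rewrite lerBrDr addrC subrr.
    + by rewrite lerBlDr (le_trans us)// (le_trans sa)// lerDl.
    + by rewrite lerBlDr (le_trans us)// (le_trans sk)// -natr1 mulrDl mul1r.
  - by move=> u u' u0 uu' us; apply: hm => //; rewrite (le_trans us)// (le_trans sa).
  - by rewrite s0' lexx.
  rewrite ha ?s0'// !mulr0 mul0r normr_le0 subr_eq0 => /eqP -> _ //.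
apply: (@delay_gap t) => //.
- by rewrite t0.
- move=> u /andP[u0 ut]; apply: (past (Num.truncn (u / r)).+1).
  + by rewrite lerBrDr addrC subrr.
  + by rewrite (le_trans _ tra)// lerB.
  + have uK : u <= (Num.truncn (u / r)).+1%:R * r.
      by rewrite -ler_pdivrMr// ltW// truncnS_gt.
    by rewrite lerBlDr (le_trans uK)// lerDl.
- by rewrite t0 lexx.
Qed.

End delay.

(** * The reproducing kernel Hilbert space of fractional Brownian motion *)

Section affine.
Context {R : realType}.
Notation mu := (@lebesgue_measure R).

Lemma continuous_comp_affine (f : R -> R) (a b : R) : continuous f ->
  continuous (fun z => f (a * z + b)).
Proof.
move=> cf x; apply: (@continuous_comp _ _ _ (fun x : R => a * x + b) f).
  by apply: cvgD; [exact: mulrl_continuous|exact: cvg_cst].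
exact: cf.
Qed.

Lemma ge0_integral_affine (f : R -> R) (c d : R) : 0 < c -> continuous f ->
  (forall x, 0 <= f x) ->
  (\int[mu]_x (f x)%:E = \int[mu]_x (f (c * x + d) * c)%:E)%E.
Proof.
move=> c0 cf f0.
pose F (x : R) : R := c * x + d.
have dF (x : R) : is_derive x 1 F c.
  by apply: is_derive_eq; rewrite addr0 /GRing.scale/= mulr1.
have F'E : F^`()%classic = cst c.
  by apply/funext => x; rewrite derive1E; exact: derive_val.
rewrite (@increasing_ge0_integration_by_substitutionT _ F f)//.
- by apply: eq_integral => x _; rewrite F'E.
- by move=> x y xy; rewrite /F ltrD2r ltr_pM2l.
- by rewrite F'E => ?; exact: cvg_cst.
- by rewrite F'E; exact: is_cvg_cst.
- by rewrite F'E; exact: is_cvg_cst.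
- apply: (@cvg_comp _ _ _ ( *%R c) (+%R^~ d) _ (-oo)); last exact: cvg_addrr_Ny.
  rewrite (_ : *%R c = *%R^~ c); last by apply/funext => x; exact: mulrC.
  exact/gt0_cvgMlNy.
- apply: (@cvg_comp _ _ _ ( *%R c) (+%R^~ d) _ (+oo)); last exact: cvg_addrr.
  rewrite (_ : *%R c = *%R^~ c); last by apply/funext => x; exact: mulrC.
  exact/gt0_cvgMly.
Qed.

Lemma ge0_integral_opp (f : R -> R) : continuous f -> (forall x, 0 <= f x) ->
  (\int[mu]_x (f (- x))%:E = \int[mu]_x (f x)%:E)%E.
Proof.
move=> cf f0.
have cg : continuous (fun x => f (- x)).
  by move=> x; apply: (continuous_comp (f := -%R)); [exact: opp_continuous|exact: cf].
have half (g : R -> R) : continuous g -> (forall x, 0 <= g x) ->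
    (\int[mu]_x (g x)%:E = \int[mu]_(x in `]-oo, 0%R]) (g x)%:E +
                           \int[mu]_(x in `[0%R, +oo[) (g x)%:E)%E.
  move=> cg' g0.
  have mg : measurable_fun [set: R] g by exact: continuous_measurable_fun.
  rewrite -[setT](@setUv _ `]-oo, 0%R]%classic) setCitvl ge0_integral_setU//=.
  - rewrite -(integral_itv_obnd_cbnd (r := 0%R))//.
    exact/measurable_EFinP/measurable_funTS.
  - by rewrite -setCitvl setUv; exact/measurable_EFinP.
  - by move=> x _; rewrite lee_fin.
  - by rewrite -setCitvl; exact/disj_setPCl.
rewrite half// [RHS]half//.
have swap (g : R -> R) : continuous g -> (forall x, 0 <= g x) ->
   (\int[mu]_(x in `]-oo, 0%R]) (g x)%:E =
     \int[mu]_(x in `[0%R, +oo[) (g (- x))%:E)%E.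
  move=> cg' g0; rewrite -{1}oppr0 ge0_integration_by_substitutionNy//.
  exact: continuous_subspaceT.
rewrite (swap _ cg)// (swap _ cf)// addeC; congr (_ + _)%E.
by apply: eq_integral => x _; rewrite opprK.
Qed.

End affine.

Section pospow.
Context {R : realType}.
Notation mu := (@lebesgue_measure R).
Variable p : R.
Hypothesis p_gt0 : 0 < p.

(** The truncated power x_+^p, from which the Mandelbrot-Van Ness kernel is built. *)
Definition pospow (x : R) : R := Num.max x 0 `^ p.

Lemma pospow_ge0 x : 0 <= pospow x. Proof. exact: powR_ge0. Qed.

Lemma pospow_le0 x : x <= 0 -> pospow x = 0.
Proof. by move=> x0; rewrite /pospow max_r// powR0// gt_eqF. Qed.

Lemma pospowE x : 0 <= x -> pospow x = x `^ p.
Proof. by move=> x0; rewrite /pospow max_l. Qed.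

Lemma pospow_gt0 x : 0 < x -> 0 < pospow x.
Proof. by move=> x0; rewrite pospowE ?ltW// powR_gt0. Qed.

Lemma le_pospow x y : x <= y -> pospow x <= pospow y.
Proof.
move=> xy; have m0 z : 0 <= Num.max z (0 : R) by rewrite le_max lexx orbT.
apply: ge0_ler_powR; rewrite ?nnegrE ?(ltW p_gt0)//.
by rewrite ge_max !le_max xy lexx orbT.
Qed.

Lemma pospowM c x : 0 < c -> pospow (c * x) = c `^ p * pospow x.
Proof.
move=> c0; have [x0|x0] := leP x 0.
  by rewrite !pospow_le0 ?mulr0// pmulr_rle0.
by rewrite !pospowE ?ltW ?mulr_gt0// powRM// ltW.
Qed.

Lemma continuous_pospow : continuous pospow.
Proof.
move=> x; have [x0|x0|->] := ltgtP x 0.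
- apply: (@near_cst_continuous _ _ 0).
  near=> y; apply/pospow_le0/ltW; near: y; exact: lt_nbhsl.
- have cx : {for x, continuous (fun y : R => y `^ p)}.
    apply: differentiable_continuous; apply/derivable1_diffP.
    by apply: derivable_powR; rewrite in_itv/= x0.
  rewrite /continuous_at pospowE ?ltW//; apply: cvg_trans cx.
  apply: near_eq_cvg; near=> y; rewrite pospowE//; apply/ltW; near: y.
  exact: lt_nbhsr.
- apply/cvgrPdist_lt => e e0; rewrite pospow_le0//.
  have d0 : 0 < e `^ p^-1 by rewrite powR_gt0.
  near=> y; rewrite sub0r normrN ger0_norm ?pospow_ge0//.
  have ye : `|y| < e `^ p^-1.
    near: y; apply/nbhs_normP; exists (e `^ p^-1) => //= z /=.
    by rewrite sub0r normrN.
  rewrite (le_lt_trans (le_pospow (ler_norm y)))// pospowE//.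
  rewrite (_ : e = (e `^ p^-1) `^ p); last first.
    by rewrite -powRrM mulVf ?gt_eqF// powRr1// ltW.
  by apply: gt0_ltr_powR; rewrite ?nnegrE// ltW.
Unshelve. all: by end_near. Qed.

(** Write y^p as y * y^(p - 1) and use that y^(p - 1) decreases. This decay makes the squared
    increment of the kernel integrable at infinity. *)
Lemma pospow_tail x : 1 <= x -> p < 1 ->
  0 <= pospow (1 + x) - pospow x <= x `^ (p - 1).
Proof.
move=> x1 p1; have x0 : 0 < x by rewrite (lt_le_trans _ x1).
rewrite subr_ge0 le_pospow ?lerDr//= !pospowE ?addr_ge0 ?(ltW x0)//.
rewrite -[X in X - _](@mulr_powRB1 _ (1 + x)) ?addr_ge0 ?(ltW x0)//.
rewrite -[X in _ - X](@mulr_powRB1 _ x) ?(ltW x0)//.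
have : (1 + x) `^ (p - 1) <= x `^ (p - 1).
  rewrite -(opprB 1 p) !powRN lef_pV2 ?posrE ?powR_gt0 ?addr_gt0//.
  by apply: ge0_ler_powR; rewrite ?nnegrE ?subr_ge0 ?addr_ge0 ?(ltW x0) ?(ltW p1)// lerDr.
have := powR_ge0 x (p - 1); have := powR_ge0 (1 + x) (p - 1); nra.
Qed.

Lemma integral_powR_tail (q : R) : 0 < q ->
  (\int[mu]_(x in `[1%R, +oo[) (x `^ (- q - 1))%:E < +oo)%E.
Proof.
move=> q0.
rewrite (@ge0_continuous_FTC2y _ _ (fun x => - q^-1 * x `^ (- q)) 1 0).
- by rewrite powR1 ltry.
- by move=> x _; exact: powR_ge0.
- apply: derivable_within_continuous => x; rewrite in_itv/= andbT => x1.
  by apply: derivable_powR; rewrite in_itv/= andbT (lt_le_trans _ x1).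
- rewrite -[X in _ --> X](mulr0 (- q^-1)); apply: cvgM; first exact: cvg_cst.
  apply/cvgrPdist_lt => e e0.
  have d0 : 0 < e^-1 `^ q^-1 by rewrite powR_gt0// invr_gt0.
  near=> x; rewrite sub0r normrN ger0_norm ?powR_ge0// powRN.
  have xe : e^-1 `^ q^-1 < x by near: x; exact: nbhs_pinfty_gt.
  have x0 : 0 < x by exact: lt_trans xe.
  rewrite -[ltRHS]invrK ltf_pV2 ?posrE ?powR_gt0 ?invr_gt0//.
  rewrite (_ : e^-1 = (e^-1 `^ q^-1) `^ q); last first.
    by rewrite -powRrM mulVf ?gt_eqF// powRr1// ltW// invr_gt0.
  by apply: gt0_ltr_powR; rewrite ?nnegrE// ltW.
- move=> x x1; have x0 : 0 < x by rewrite (lt_trans _ x1).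
  by apply: ex_derive; apply: is_deriveM; apply: is_derive1_powR.
- have cx : {for 1, continuous (fun x : R => - q^-1 * x `^ (- q))}.
    apply: differentiable_continuous; apply/derivable1_diffP.
    by apply: ex_derive; apply: is_deriveM; apply: is_derive1_powR.
  by apply: cvg_at_right_filter; exact: cx.
- move=> x; rewrite in_itv/= andbT => x1; have x0 : 0 < x by rewrite (lt_trans _ x1).
  rewrite derive1E (_ : (fun x : R => _) = (- q^-1) \*: (fun x : R => x `^ (- q)))//.
  rewrite deriveZ/=; last by apply: derivable_powR; rewrite in_itv/= x0.
  rewrite -derive1E powR_derive1 ?in_itv/= ?x0// /GRing.scale/=.
  by rewrite mulrA mulrNN mulVf ?mul1r// gt_eqF.
Unshelve. all: by end_near. Qed.

End pospow.

Section has_integral.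
Context {d : measure_display} {T : measurableType d} {R : realType}.
Variable mu : {measure set T -> \bar R}.

(** Integrability travels with the value, so that a linear computation of integrals establishes both
    at once. *)
Definition has_integral (D : set T) (f : T -> R) (v : R) :=
  mu.-integrable D (EFin \o f) /\ \int[mu]_(x in D) f x = v.

Lemma has_integralD D f g v w : measurable D ->
  has_integral D f v -> has_integral D g w ->
  has_integral D (fun x => f x + g x) (v + w).
Proof.
move=> mD [if_ <-] [ig <-]; split; last by rewrite RintegralD.
exact: (integrableD mD if_ ig).
Qed.

Lemma has_integralZ D f v k : measurable D ->
  has_integral D f v -> has_integral D (fun x => k * f x) (k * v).
Proof.
move=> mD [if_ <-]; split; last by rewrite RintegralZl.
exact: (integrableZl mD k if_).
Qed.

Lemma has_integralB D f g v w : measurable D ->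
  has_integral D f v -> has_integral D g w ->
  has_integral D (fun x => f x - g x) (v - w).
Proof.
move=> mD [if_ <-] [ig <-]; split; last by rewrite RintegralB.
exact: (integrableB mD if_ ig).
Qed.

Lemma has_integral_sum D (I : eqType) (s : seq I) (F : I -> T -> R) (v : I -> R) :
  measurable D -> (forall i, i \in s -> has_integral D (F i) (v i)) ->
  has_integral D (fun x => \sum_(i <- s) F i x) (\sum_(i <- s) v i).
Proof.
move=> mD; elim: s => [|i s IH] H.
  rewrite big_nil (_ : (fun x => _) = cst 0); last first.
    by apply/funext => x; rewrite big_nil.
  split; first exact: integrable0.
  by rewrite /Rintegral integral0.
rewrite big_cons (_ : (fun x => _) =
    (fun x => F i x + \sum_(j <- s) F j x)); last first.
  by apply/funext => x; rewrite big_cons.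
apply: has_integralD => //; first by apply: H; rewrite mem_head.
by apply: IH => j js; apply: H; rewrite inE js orbT.
Qed.

Lemma has_integral_ge0 (f : T -> R) v : measurable_fun setT f ->
  (forall x, 0 <= f x) -> (\int[mu]_x (f x)%:E = v%:E)%E -> has_integral setT f v.
Proof.
move=> mf f0 fv; split; last by rewrite /Rintegral fv.
apply/integrableP; split; first exact/measurable_EFinP.
under eq_integral do rewrite /= ger0_norm//.
by rewrite fv ltry.
Qed.

End has_integral.

Section combinations.
Context {R : realType}.
Implicit Types c d : seq (R * R).

(** A list of pairs (coefficient, time) encodes a finite linear combination of coordinates of the
    process. When K is its covariance, this is the covariance of two such combinations. *)
Definition kernel_ip (K : R -> R -> R) c d : R :=
  \sum_(x <- c) \sum_(y <- d) x.1 * y.1 * K x.2 y.2.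

Definition comb_eval (h : R -> R) c : R := \sum_(x <- c) x.1 * h x.2.

Definition comb_scale (k : R) c := [seq (k * x.1, x.2) | x <- c].

Lemma kernel_ip_catl K c c' d :
  kernel_ip K (c ++ c') d = kernel_ip K c d + kernel_ip K c' d.
Proof. by rewrite /kernel_ip big_cat. Qed.

Lemma kernel_ip_catr K c d d' :
  kernel_ip K c (d ++ d') = kernel_ip K c d + kernel_ip K c d'.
Proof. by rewrite /kernel_ip -big_split; apply: eq_bigr => x _; rewrite big_cat. Qed.

Lemma kernel_ip_scalel K k c d : kernel_ip K (comb_scale k c) d = k * kernel_ip K c d.
Proof.
rewrite /kernel_ip big_map mulr_sumr; apply: eq_bigr => x _.
by rewrite mulr_sumr; apply: eq_bigr => y _; rewrite !mulrA.
Qed.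

Lemma kernel_ip_scaler K k c d : kernel_ip K c (comb_scale k d) = k * kernel_ip K c d.
Proof.
rewrite /kernel_ip mulr_sumr; apply: eq_bigr => x _.
by rewrite big_map mulr_sumr; apply: eq_bigr => y _ /=; ring.
Qed.

Lemma comb_eval_cat h c d : comb_eval h (c ++ d) = comb_eval h c + comb_eval h d.
Proof. by rewrite /comb_eval big_cat. Qed.

Lemma comb_eval_scale h k c : comb_eval h (comb_scale k c) = k * comb_eval h c.
Proof.
by rewrite /comb_eval big_map mulr_sumr; apply: eq_bigr => x _; rewrite mulrA.
Qed.

Definition ipE := (kernel_ip_catl, kernel_ip_catr, kernel_ip_scalel,
  kernel_ip_scaler, comb_eval_cat, comb_eval_scale).

End combinations.

Definition fbm_ip {R : realType} (H : R) := kernel_ip (@fbm_cov R H).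

Section mvn.
Context {R : realType}.
Notation mu := (@lebesgue_measure R).
Variable H : R.
Hypothesis H_range : 2^-1 < H < 1.
Let p : R := H - 2^-1.
Let p_gt0 : 0 < p. Proof. by rewrite subr_gt0; case/andP: H_range. Qed.
Let p_lt1 : p < 1. Proof. by case/andP: H_range => ? ?; rewrite /p; lra. Qed.
Notation k := (pospow p).

Let G (x : R) := (k (1 + x) - k x) ^+ 2.

Let ck := continuous_pospow p_gt0.

Let ckB (s t : R) : continuous (fun u => k (s + u) - k (t + u)).
Proof.
have ca (v : R) : continuous (fun u => k (v + u)).
  move=> x; apply: (continuous_comp (f := +%R v)); last exact: ck.
  by apply: cvgD; [exact: cvg_cst|exact: cvg_id].
by move=> x; apply: cvgB; exact: ca.
Qed.

Let ckN (s t : R) : continuous (fun u => k (s - u) - k (t - u)).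
Proof.
move=> x; apply: (@continuous_comp _ _ _ -%R (fun u => k (s + u) - k (t + u))).
  exact: opp_continuous.
exact: ckB.
Qed.

Let csqr (f : R -> R) : continuous f -> continuous (fun x => f x ^+ 2).
Proof. by move=> cf x; apply: cvgM; exact: cf. Qed.

Let GE : G = fun x => (k (1 + x) - k (0 + x)) ^+ 2.
Proof. by apply/funext => x; rewrite add0r. Qed.

Let mG : measurable_fun [set: R] G.
Proof. by rewrite GE; apply: continuous_measurable_fun; exact: csqr. Qed.

(** The integrand vanishes below -1, is at most [k 2 ^+ 2] on [-1, 1], and beyond 1 is at most x^(2p
    - 2), which is integrable because p < 1/2, that is, H < 1. *)
Lemma mvn_const_fin : (\int[mu]_x (G x)%:E < +oo)%E.
Proof.
have G0 (x : R) : (0 <= (G x)%:E)%E by rewrite lee_fin sqr_ge0.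
rewrite -[setT](@setUv _ `]-oo, 1%R[%classic) setCitvl ge0_integral_setU//=.
- rewrite lte_add_pinfty//.
  + apply: (@le_lt_trans _ _ (\int[mu]_(x in `]-oo, 1%R[)
        ((k 2 ^+ 2) * \1_(`[-1, 1]%classic : set R) x)%:E)%E).
      apply: ge0_le_integral => //.
      * exact/measurable_EFinP/measurable_funTS.
      * apply/measurable_EFinP; apply: measurable_funM => //.
      move=> x /=; rewrite in_itv/= => x1; rewrite lee_fin indicE.
      have [xm1|xm1] := ltP x (-1).
        have x10 : 1 + x <= 0 by lra.
        have x00 : x <= 0 by lra.
        rewrite /G (pospow_le0 p_gt0 x10) (pospow_le0 p_gt0 x00) subrr expr0n/=.
        by rewrite mulr_ge0// sqr_ge0.
      rewrite mem_set/= ?in_itv/= ?xm1 ?(ltW x1)// mulr1.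
      have k1 : k x <= k (1 + x) by rewrite le_pospow// lerDr.
      have k2 : k (1 + x) <= k 2 by rewrite le_pospow//; lra.
      have k0 := pospow_ge0 p x.
      by rewrite ler_sqr ?nnegrE ?pospow_ge0 ?subr_ge0//; lra.
    under eq_integral do rewrite EFinM.
    rewrite ge0_integralZl//=.
    * rewrite integral_indic// lte_mul_pinfty ?lee_fin ?sqr_ge0//.
      apply: (@le_lt_trans _ _ (mu `[-1, 1])).
        by rewrite le_measure ?inE//; exact: measurableI.
      by rewrite lebesgue_measure_itv/=; case: ifP => _; exact: ltry.
    * exact/measurable_EFinP/measurable_funTS/measurable_indic.
    * by rewrite lee_fin sqr_ge0.
  + have q0 : 0 < 1 - 2 * p by rewrite /p; case/andP: H_range => ? ?; lra.
    apply: le_lt_trans (integral_powR_tail q0).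
    apply: ge0_le_integral => //.
    * exact/measurable_EFinP/measurable_funTS.
    * apply/measurable_EFinP/measurable_funTS. exact: measurable_powR.
    move=> x /=; rewrite in_itv/= andbT => x1; rewrite lee_fin.
    have /andP[a1 a2] := pospow_tail p_gt0 x1 p_lt1.
    rewrite (_ : - (1 - 2 * p) - 1 = (p - 1) + (p - 1)); last by ring.
    rewrite powRD; last by rewrite (@gt_eqF _ _ x) ?implybT// (lt_le_trans _ x1).
    by rewrite -expr2 ler_sqr ?nnegrE// powR_ge0.
- by rewrite -setCitvl setUv; exact/measurable_EFinP.
- by rewrite -setCitvl; exact/disj_setPCl.
Qed.

Definition mvn_const : R := fine (\int[mu]_x (G x)%:E)%E.
Notation C := mvn_const.

Let CE : (\int[mu]_x (G x)%:E = C%:E)%E.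
Proof.
rewrite /C fineK// ge0_fin_numE; first exact: mvn_const_fin.
by apply: integral_ge0 => x _; rewrite lee_fin sqr_ge0.
Qed.

(** On [-1/2, 0] the term [k x] vanishes and [k (1 + x)] is at least [k (1/2)]. *)
Lemma mvn_const_gt0 : 0 < C.
Proof.
rewrite -lte_fin -CE.
apply: (@lt_le_trans _ _ (\int[mu]_(x in `[(- 2^-1)%R, 0%R]) ((k 2^-1)%R ^+ 2)%:E)%E).
  rewrite integral_cst//= lebesgue_measure_itv/= lte_fin.
  rewrite ifT; last lra.
  by rewrite -EFinB -EFinM lte_fin mulr_gt0 ?exprn_gt0 ?pospow_gt0//; lra.
apply: (@le_trans _ _ (\int[mu]_(x in `[(- 2^-1)%R, 0%R]) (G x)%:E)%E).
  apply: ge0_le_integral => //.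
  - by move=> x _; rewrite lee_fin sqr_ge0.
  - exact/measurable_EFinP/measurable_funTS.
  move=> x /=; rewrite in_itv/= => /andP[x1 x0].
  rewrite lee_fin /G (pospow_le0 p_gt0 x0) subr0.
  rewrite ler_sqr ?nnegrE ?pospow_ge0// le_pospow//; lra.
apply: ge0_subset_integral => //.
- exact/measurable_EFinP.
- by move=> x _; rewrite lee_fin sqr_ge0.
Qed.

(** After a reflection, the substitution u |-> (s - t) u - t and the homogeneity of k reduce the
    integral to that of [G]; squaring k and the Jacobian contribute the exponent 2p + 1 = 2H. *)
Lemma mvn_incr (s t : R) : has_integral mu setT
  (fun u => (k (s - u) - k (t - u)) ^+ 2) (C * `|s - t| `^ (2 * H)).
Proof.
wlog st : s t / t <= s.
  move=> W; have [|/ltW ts] := leP t s; first exact: W.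
  have := W _ _ ts; rewrite distrC; congr has_integral.
  by apply/funext => u; rewrite -sqrrN opprB.
apply: has_integral_ge0.
- by apply: continuous_measurable_fun; exact: csqr.
- by move=> u; exact: sqr_ge0.
move: st; rewrite le_eqVlt => /predU1P[<-|ts].
  rewrite subrr normr0 powR0 ?mulr0; last first.
    by apply/eqP; case/andP: H_range => ? ?; lra.
  by under eq_integral do rewrite subrr expr0n/=; rewrite integral0.
have c0 : 0 < s - t by rewrite subr_gt0.
rewrite -ge0_integral_opp; last 2 first.
- exact: csqr.
- by move=> u; exact: sqr_ge0.
under eq_integral do rewrite !opprK.
rewrite (@ge0_integral_affine _ _ (s - t) (- t))//; last 2 first.
- exact: csqr.
- by move=> u; exact: sqr_ge0.
under eq_integral => u _.
  rewrite (_ : s + _ = (s - t) * (1 + u)); last by ring.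
  rewrite (_ : t + _ = (s - t) * u); last by ring.
  rewrite !pospowM// -mulrBr exprMn mulrAC.
  rewrite (_ : _ ^+ 2 * (s - t) = `|s - t| `^ (2 * H)); last first.
    rewrite gtr0_norm// -[X in _ * X](powRr1 (ltW c0)) expr2.
    rewrite -!powRD ?(gt_eqF c0) ?implybT//; congr powR.
    by rewrite /p; field.
  rewrite EFinM.
  over.
rewrite ge0_integralZl//=.
- by rewrite -/(G _) CE -EFinM mulrC.
- exact/measurable_EFinP.
- by move=> x _; rewrite lee_fin sqr_ge0.
Qed.

(* The Mandelbrot-Van Ness kernel: by [mvn_quad], covariances of the fractional
   Brownian motion are L2 inner products of these kernels, up to [mvn_const]. *)
Definition mvn (s u : R) := k (s - u) - k (- u).

(** Polarization: the product of two kernels is half of the sum of their squares minus the square of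
    their difference, which matches [fbm_cov] term by term once [mvn_incr] is applied. Nonnegative
    times are used to write |x.2 - 0| as x.2. *)
Lemma mvn_quad (c : seq (R * R)) : all (fun x => 0 <= x.2) c ->
  has_integral mu setT (fun u => (\sum_(x <- c) x.1 * mvn x.2 u) ^+ 2)
    (C * fbm_ip H c c).
Proof.
move=> /allP c0.
rewrite (_ : (fun u => _) = (fun u => \sum_(x <- c) \sum_(y <- c)
   x.1 * y.1 / 2 * ((k (x.2 - u) - k (0 - u)) ^+ 2 +
     (k (y.2 - u) - k (0 - u)) ^+ 2 - (k (x.2 - u) - k (y.2 - u)) ^+ 2))); last first.
  apply/funext => u; rewrite expr2 mulr_suml; apply: eq_bigr => x _.
  rewrite mulr_sumr; apply: eq_bigr => y _.
  by rewrite /mvn sub0r; field.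
rewrite /fbm_ip /kernel_ip mulr_sumr; apply: has_integral_sum => // x xc.
rewrite mulr_sumr; apply: has_integral_sum => // y yc.
rewrite (_ : C * _ = x.1 * y.1 / 2 * (C * `|x.2 - 0| `^ (2 * H) +
   C * `|y.2 - 0| `^ (2 * H) - C * `|x.2 - y.2| `^ (2 * H))); last first.
  by rewrite /fbm_cov !subr0 (ger0_norm (c0 _ xc)) (ger0_norm (c0 _ yc)); field.
apply: has_integralZ => //; apply: has_integralB => //; last exact: mvn_incr.
by apply: has_integralD => //; exact: mvn_incr.
Qed.

End mvn.

Section direction.
Context {R : realType}.
Notation mu := (@lebesgue_measure R).

(** Integrate (f - m)^2 >= 0, where m is the mean of f over the interval. *)
Lemma sqr_Rintegral_le (f : R -> R) (a b : R) : a < b -> continuous f ->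
  (\int[mu]_(u in `[a, b]) f u) ^+ 2 <= (b - a) * \int[mu]_(u in `[a, b]) (f u ^+ 2).
Proof.
move=> ab cf; have ba : 0 < b - a by rewrite subr_gt0.
have ci (g : R -> R) : continuous g -> has_integral mu `[a, b] g (\int[mu]_(u in `[a, b]) g u).
  move=> cg; split => //; apply: continuous_compact_integrable.
    exact: segment_compact.
  exact: continuous_subspaceT.
have csq : continuous (fun u => f u ^+ 2) by move=> x; apply: cvgM; exact: cf.
set J := \int[mu]_(u in `[a, b]) f u; set Q := \int[mu]_(u in `[a, b]) (f u ^+ 2).
pose m := J / (b - a).
have hc : has_integral mu `[a, b] (fun=> m ^+ 2) (m ^+ 2 * (b - a)).
  rewrite (_ : m ^+ 2 * (b - a) = \int[mu]_(u in `[a, b]) (m ^+ 2)).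
    by apply: ci; move=> x; exact: cvg_cst.
  by rewrite Rintegral_cst//= lebesgue_measure_itv/= lte_fin ab.
have hI : has_integral mu `[a, b] (fun u => f u ^+ 2 - (2 * m) * f u + m ^+ 2)
    (Q - (2 * m) * J + m ^+ 2 * (b - a)).
  apply: has_integralD => //; apply: has_integralB => //; first exact: ci.
  by apply: has_integralZ => //; exact: ci.
have : 0 <= Q - (2 * m) * J + m ^+ 2 * (b - a).
  case: hI => _ <-; apply: Rintegral_ge0 => u _.
  by rewrite (_ : _ + _ = (f u - m) ^+ 2) ?sqr_ge0//; ring.
rewrite (_ : Q - _ + _ = Q - J ^+ 2 / (b - a)); last by rewrite /m; field; rewrite gt_eqF.
by rewrite subr_ge0 ler_pdivrMr// mulrC.
Qed.

Variable H : R.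
Hypothesis H_range : 2^-1 < H < 1.
Let p : R := H - 2^-1.
Let p_gt0 : 0 < p. Proof. by rewrite subr_gt0; case/andP: H_range. Qed.
Notation k := (pospow p).
Let ck := continuous_pospow p_gt0.

Let cks s : continuous (fun u => k (s - u)).
Proof.
move=> x; apply: (@continuous_comp _ _ _ (fun u => s - u) k); last exact: ck.
by apply: cvgB; [exact: cvg_cst|exact: cvg_id].
Qed.

Let ck2 u : continuous (fun s => k (s - u)).
Proof.
move=> x; apply: (@continuous_comp _ _ _ (fun s => s - u) k); last exact: ck.
by apply: cvgB; [exact: cvg_id|exact: cvg_cst].
Qed.

Variables a t T : R.
Hypotheses (a_ge0 : 0 <= a) (a_lt_t : a < t) (t_le_T : t <= T).
Let aT : a < T := lt_le_trans a_lt_t t_le_T.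

(* The L2 inner product of [mvn H s] with the indicator of [a, T]; it belongs to
   the reproducing kernel Hilbert space by the Cauchy-Schwarz inequality. *)
Definition direction (s : R) := \int[mu]_(u in `[a, T]) k (s - u).

Let ik s : has_integral mu `[a, T] (fun u => k (s - u)) (direction s).
Proof.
split => //; apply: continuous_compact_integrable; first exact: segment_compact.
exact: continuous_subspaceT.
Qed.

Lemma direction_le0 s : s <= a -> direction s = 0.
Proof.
move=> sa; rewrite /direction (@eq_Rintegral _ _ _ _ _ (fun=> 0)).
  by rewrite Rintegral_cst// mul0r.
move=> u; rewrite inE/= in_itv/= => /andP[au _]; apply: pospow_le0 => //.
by rewrite subr_le0 (le_trans sa).
Qed.

Lemma le_direction s s' : s <= s' -> direction s <= direction s'.
Proof.
move=> ss'; apply: le_Rintegral => //; [by case: (ik s)|by case: (ik s')|].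
by move=> u _; apply: le_pospow => //; rewrite lerB.
Qed.

Lemma direction_gt0 : 0 < direction t.
Proof.
pose m := (a + t) / 2.
have am : a < m by rewrite /m; move: a_lt_t; lra.
have mt : m < t by rewrite /m; move: a_lt_t; lra.
have mT : m <= T by rewrite (le_trans _ t_le_T)// ltW.
have ikm : mu.-integrable `[a, m] (EFin \o (fun u => k (t - u))).
  apply: continuous_compact_integrable; first exact: segment_compact.
  exact: continuous_subspaceT.
apply: (@lt_le_trans _ _ (\int[mu]_(u in `[a, m]) k (t - m))).
  rewrite Rintegral_cst//= lebesgue_measure_itv/= lte_fin am/=.
  by rewrite mulr_gt0// ?subr_gt0// pospow_gt0// subr_gt0.
apply: (@le_trans _ _ (\int[mu]_(u in `[a, m]) k (t - u))).
  apply: le_Rintegral => //.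
    apply: continuous_compact_integrable; first exact: segment_compact.
    by apply: continuous_subspaceT => x; exact: cvg_cst.
  move=> u /=; rewrite in_itv/= => /andP[_ um]; apply: le_pospow => //.
  by rewrite lerB.
have [ikT _] := ik t.
rewrite /direction /Rintegral fine_le//; try exact: integrable_fin_num.
apply: ge0_subset_integral => //.
- by case/integrableP : ikT.
- by move=> u _; rewrite lee_fin pospow_ge0.
- by apply: subset_itvl; rewrite bnd_simp.
Qed.

Lemma continuous_direction : {within `[0, T], continuous direction}.
Proof.
have T0 : 0 <= T by rewrite (le_trans a_ge0)// ltW.
apply: continuous_in_subspaceT => s; rewrite inE/= in_itv/= => /andP[s0 sT].
(* The parameter runs over the open interval (-1, T + 1) around [0, T]; there s - u < T + 1 because
   u >= a >= 0, so the constant [k (T + 1)] dominates. *)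
have := @continuity_under_integral R _ _ mu (fun s u => k (s - u)) `[a, T]%classic
  (measurable_itv _) (- 1) (T + 1) _ _ (fun=> k (T + 1)) _ _ s.
apply.
- by move=> x _; case: (ik x).
- by apply: aeW => y _ x _; exact: ck2.
- apply: continuous_compact_integrable; first exact: segment_compact.
  by apply: continuous_subspaceT => x; exact: cvg_cst.
- move=> x; rewrite /= in_itv/= => /andP[_ xT]; apply: aeW => u /=.
  rewrite in_itv/= => /andP[au _]; rewrite ger0_norm ?pospow_ge0//.
  by apply: le_pospow => //; have := a_ge0; lra.
- rewrite inE/= in_itv/=; apply/andP; split; lra.
Qed.

(** On [a, T] the subtracted term [k (- u)] of [mvn] vanishes, so Cauchy-Schwarz bounds the left
    side by the squared kernel combination integrated over [a, T]; enlarging the domain to the whole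
    line yields [mvn_quad]. *)
Lemma direction_rkhs (c : seq (R * R)) : all (fun x => 0 <= x.2) c ->
  comb_eval direction c ^+ 2 <= (T - a) * mvn_const H * fbm_ip H c c.
Proof.
move=> c0; pose S u := \sum_(x <- c) x.1 * k (x.2 - u).
have iS : has_integral mu `[a, T] S (comb_eval direction c).
  by apply: has_integral_sum => // x _; apply: has_integralZ.
have cS : continuous S.
  rewrite /S; elim: c {c0 S iS} => [|x c IH] u.
    by under eq_fun do rewrite big_nil; exact: cvg_cst.
  rewrite (_ : (fun v => _) = (fun v => x.1 * k (x.2 - v)) \+
      (fun v => \sum_(y <- c) y.1 * k (y.2 - v))); last first.
    by apply/funext => v; rewrite big_cons.
  by apply: cvgD; [apply: cvgM; [exact: cvg_cst|exact: cks]|exact: IH].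
have [_ <-] := iS.
apply: (le_trans (sqr_Rintegral_le aT cS)).
rewrite -mulrA ler_pM2l ?subr_gt0//.
have [iQ <-] := mvn_quad H_range c0.
have mQ := measurable_int _ iQ.
rewrite [leLHS](_ : _ = \int[mu]_(u in `[a, T])
    ((\sum_(x <- c) x.1 * mvn H x.2 u) ^+ 2)); last first.
  apply: eq_Rintegral => u; rewrite inE/= in_itv/= => /andP[au _]; congr (_ ^+ 2).
  apply: eq_bigr => x _; rewrite /mvn (@pospow_le0 _ _ p_gt0 (- u)) ?subr0//.
  by rewrite oppr_le0 (le_trans a_ge0).
rewrite /Rintegral fine_le//.
- by apply: integrable_fin_num => //; exact: integrableS iQ.
- exact: integrable_fin_num.
- apply: ge0_subset_integral => //.
  by move=> u _; rewrite lee_fin sqr_ge0.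
Qed.

End direction.

(** * Riesz representation by a minimizing sequence *)

Section riesz.
Context {R : realType}.
Variables (K : R -> R -> R) (h : R -> R) (D : pred R) (C0 : R).
Hypothesis K_sym : forall s t, K s t = K t s.
Hypothesis C0_gt0 : 0 < C0.
Notation good c := (all (fun x : R * R => D x.2) c).
Hypothesis h_bounded : forall c, good c ->
  comb_eval h c ^+ 2 <= C0 * kernel_ip K c c.
Variable t : R.
Hypotheses (Dt : D t) (ht : h t != 0).

Notation ip := (kernel_ip K).
Notation ell := (comb_eval h).

Lemma kernel_ipC c d : ip c d = ip d c.
Proof.
rewrite /kernel_ip exchange_big; apply: eq_bigr => x _; apply: eq_bigr => y _.
by rewrite K_sym (mulrC x.1).
Qed.

Let good_cat c d : good c -> good d -> good (c ++ d).
Proof. by rewrite all_cat => -> ->. Qed.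

Let good_scale k c : good c -> good (comb_scale k c).
Proof. by rewrite all_map => /allP gc; apply/allP => x /gc. Qed.

Let ip_ge0 c : good c -> 0 <= ip c c.
Proof.
by move=> /h_bounded; rewrite -(pmulr_rge0 _ C0_gt0); apply: le_trans; exact: sqr_ge0.
Qed.

(** The functional minimized, in the completion, by the Riesz representative of [ell]; its infimum
    is minus the squared norm of that representative. *)
Let J c := ip c c - 2 * ell c.

Let J_ge c : good c -> - C0 <= J c.
Proof.
move=> gc; rewrite /J; have := h_bounded gc.
have : 0 <= (ell c - C0) ^+ 2 by exact: sqr_ge0.
(* By [h_bounded] this product is at least (ell c - C0)^2. *)
move=> a b; suff : 0 <= C0 * (ip c c - 2 * ell c + C0) by rewrite pmulr_rge0//; lra.
nra.
Qed.

Let S : set R := [set J c | c in [set c | good c]].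

Let m := inf S.

Let S_inf : has_inf S.
Proof.
split; first by exists (J [::]); exists [::].
by exists (- C0) => _ [c gc <-]; exact: J_ge.
Qed.

Let J_ge_m c : good c -> m <= J c.
Proof.
by move=> gc; apply: ge_inf; [case: S_inf|exists c].
Qed.

Let near_min e : 0 < e -> exists2 c, good c & J c < m + e.
Proof.
move=> e0; have [_ [c gc <-] Jc] := inf_adherent e0 S_inf.
by exists c.
Qed.

Let m_lt0 : m < 0.
Proof.
have g1 : good [:: (1, t)] by rewrite /= Dt.
have q0 := ip_ge0 g1; set q := ip _ _ in q0.
have e1 : ell [:: (1, t)] = h t by rewrite /comb_eval big_seq1 mul1r.
(* The optimal multiple of the coordinate at t would be h t / q; q + 1 avoids a division by zero and
   still makes J negative. *)
apply: (le_lt_trans (J_ge_m (good_scale (h t / (q + 1)) g1))).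
rewrite /J !ipE -/q e1.
have q1 : 0 < q + 1 by rewrite ltr_wpDl.
rewrite (_ : _ - _ = - ((h t ^+ 2) * ((q + 2) / (q + 1) ^+ 2))); last first.
  by field; rewrite gt_eqF.
rewrite oppr_lt0 mulr_gt0 ?exprn_even_gt0// divr_gt0 ?exprn_gt0//.
by rewrite ltr_wpDl.
Qed.

(** Parallelogram identity: |c - d|^2 = 2 J(c) + 2 J(d) - 4 J((c + d)/2), and the midpoint satisfies
    J >= m. *)
Let gap c d e e' : good c -> good d -> J c < m + e -> J d < m + e' ->
  ip (d ++ comb_scale (-1) c) (d ++ comb_scale (-1) c) <= 2 * (e + e').
Proof.
move=> gc gd; have := J_ge_m (good_scale 2^-1 (good_cat gc gd)).
rewrite /J !ipE (kernel_ipC d c); lra.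
Qed.

(** Approximate Euler equation: moving c along d by -u/(q + 1), with u the defect, cannot lower J by
    more than e. *)
Let perturb c d e : good c -> good d -> J c < m + e ->
  (ip c d - ell d) ^+ 2 <= e * (ip d d + 1).
Proof.
move=> gc gd Jc.
have q0 := ip_ge0 gd; set q := ip d d in q0 *.
have q1 : 0 < q + 1 by rewrite ltr_wpDl.
set u := ip c d - ell d.
have := J_ge_m (good_cat gc (good_scale (- (u / (q + 1))) gd)).
move: Jc; rewrite /J !ipE (kernel_ipC d c) -/q => Jc Jm.
have k1 : 0 <= e - 2 * (u / (q + 1)) * u + (u / (q + 1)) ^+ 2 * q.
  by rewrite {2}/u; nra.
have k2 : 0 <= e * (q + 1) ^+ 2 - u ^+ 2 * (q + 2).
  rewrite (_ : _ - _ =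
      (q + 1) ^+ 2 * (e - 2 * (u / (q + 1)) * u + (u / (q + 1)) ^+ 2 * q)).
    by rewrite mulr_ge0// sqr_ge0.
  by field; rewrite gt_eqF.
have u0 : 0 <= u ^+ 2 by exact: sqr_ge0.
rewrite -(ler_pM2r q1); nra.
Qed.

(* A minimizing sequence of [J] approximates the Riesz representative of h by
   finite combinations of the coordinates, at a geometric rate which will give
   almost sure convergence of the corresponding random variables. *)
Lemma riesz_sequence : exists (N : nat -> seq (R * R)) (v : R),
  [/\ forall n, good (N n), 0 < v,
      ip (N n) (N n) @[n --> \oo] --> v,
      forall d, good d -> ip (N n) d @[n --> \oo] --> ell d &
      forall n, ip (N n.+1 ++ comb_scale (-1) (N n))
                   (N n.+1 ++ comb_scale (-1) (N n)) <= ((2^-1) ^+ n) ^+ 2].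
Proof.
pose z : R := 2^-1.
have z0 n : 0 < z ^+ n by rewrite exprn_gt0// invr_gt0.
have z01 : 0 <= z < 1 by rewrite /z; apply/andP; split; lra.
have [zge0 zlt1] := andP z01.
have zgt0 : 0 < z by rewrite /z; lra.
have z1 n : z ^+ n <= 1 by rewrite exprn_ile1// ltW.
(* With this choice [gap] bounds the squared distance of consecutive terms by 2 (delta n + delta (n
   + 1)) = 5/8 * 4^(-n). *)
pose delta n := (z ^+ n) ^+ 2 / 4.
have d0 n : 0 < delta n by rewrite divr_gt0// exprn_gt0.
have /choice[N HN] n : exists c, good c /\ J c < m + delta n.
  by have [c gc Jc] := near_min (d0 n); exists c.
have gN n : good (N n) by case: (HN n).
have JN n : J (N n) < m + delta n by case: (HN n).
have small (u : nat -> R) M : 0 <= M -> (forall n, u n ^+ 2 <= delta n * M) ->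
    u n @[n --> \oo] --> 0.
  move=> M0 uM; apply/norm_cvg0P.
  have : z ^+ n * (M + 1) @[n --> \oo] --> 0.
    rewrite -[X in _ --> X](mul0r (M + 1)); apply: cvgM; last exact: cvg_cst.
    by apply: cvg_expr; rewrite ger0_norm.
  apply: squeeze_cvgr; last exact: cvg_cst.
  near=> n; rewrite normr_ge0/=.
  rewrite -(@ler_sqr _ `|u n|) ?nnegrE ?mulr_ge0 ?addr_ge0 ?(ltW (z0 n))//.
  rewrite -normrX ger0_norm ?sqr_ge0// (le_trans (uM n))// exprMn /delta.
  by rewrite -mulrA ler_pM2l ?exprn_gt0//; nra.
have conv d : good d -> ip (N n) d @[n --> \oo] --> ell d.
  move=> gd; apply/subr_cvg0; apply: (small _ (ip d d + 1)).
    by rewrite addr_ge0// ip_ge0.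
  by move=> n; exact: perturb.
(* A uniform bound on the norms allows [perturb] to be used with d equal to [N n] itself: ip - ell
   tends to 0, and combined with J -> m this forces ip -> -m. *)
have qb n : ip (N n) (N n) <= 2 * (1 + 2 * C0).
  have := JN n; rewrite /J; have := h_bounded (gN n).
  have dn : delta n <= 1.
    rewrite /delta; have := z1 n; have := z0 n; set y := z ^+ n; nra.
  have : 0 <= (ell (N n) - 2 * C0) ^+ 2 by exact: sqr_ge0.
  move: (ell _) (ip _ _) => l q l2 lq Jq; have m0 := m_lt0.
  have : 4 * C0 * l <= C0 * q + 4 * C0 ^+ 2 by nra.
  move=> l3; have : 4 * l <= q + 4 * C0 by rewrite -(ler_pM2l C0_gt0); nra.
  lra.
exists N, (- m); split => //.
- by rewrite oppr_gt0.
- have e1 : ip (N n) (N n) - ell (N n) @[n --> \oo] --> 0.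
    apply: (small _ (2 * (1 + 2 * C0) + 1)); first by have := C0_gt0; lra.
    move=> n; apply: (le_trans (perturb (gN n) (gN n) (JN n))).
    by rewrite ler_pM2l// lerD2r.
  have e2 : J (N n) - m @[n --> \oo] --> 0.
    have dz : delta n @[n --> \oo] --> 0.
      apply: (small _ 1) => // n; rewrite mulr1 expr2 ler_piMl// ?ltW//.
      rewrite /delta; have := z1 n; have := z0 n; set y := z ^+ n; nra.
    apply: squeeze_cvgr dz; last exact: cvg_cst.
    near=> n; rewrite subr_ge0 J_ge_m//= lerBlDl; exact: ltW.
  have -> : - m = 2 * 0 - 0 - m by rewrite mulr0 subrr sub0r.
  rewrite (_ : (fun n => _) = (fun n => 2 * (ip (N n) (N n) - ell (N n))
      - (J (N n) - m) - m)).
    apply: cvgB; last exact: cvg_cst.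
    by apply: cvgB e2; apply: cvgM e1; exact: cvg_cst.
  by apply/funext => n; rewrite /J; ring.
- move=> n; apply: (le_trans (gap (gN n) (gN n.+1) (JN n) (JN n.+1))).
  have E : (z ^+ n.+1) ^+ 2 = (z ^+ n) ^+ 2 / 4.
    by rewrite [z ^+ n.+1]exprS exprMn mulrC; congr (_ * _); rewrite /z; field.
  rewrite /delta E -/z; have := sqr_ge0 (z ^+ n); lra.
Unshelve. all: by end_near. Qed.

End riesz.

(** * Gaussian laws through their cosine transforms *)

Section std_gaussian.
Context {R : realType}.
Notation mu := (@lebesgue_measure R).

Definition gauss : probability (measurableTypeR R) R := normal_prob 0 1.

Notation phi := (normal_pdf (0 : R) 1).

Lemma normal_pdf_affine (m s x : R) : 0 < s ->
  normal_pdf m s (s * x + m) * s = phi x.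
Proof.
move=> s0; rewrite !normal_pdfE ?gt_eqF// /normal_peak /normal_fun.
rewrite addrK subr0 expr1n exprMn.
rewrite (_ : - (s ^+ 2 * x ^+ 2) / (s ^+ 2 *+ 2) = - x ^+ 2 / (1 *+ 2)); last first.
  by field; rewrite gt_eqF.
rewrite mulrAC; congr (_ * _).
rewrite -mulrnAr sqrtrM ?sqr_ge0// sqrtr_sqr gtr0_norm// mul1r.
by rewrite invfM mulrAC mulVf ?mul1r// gt_eqF.
Qed.

(** The density agrees almost everywhere with the Radon-Nikodym derivative, since both have the same
    integral over every measurable set. *)
Lemma ge0_integral_normal_prob (m s : R) (f : R -> R) : continuous f ->
  (forall x, 0 <= f x) ->
  (\int[normal_prob m s]_x (f x)%:E =
   \int[mu]_x (f x * normal_pdf m s x)%:E)%E.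
Proof.
move=> cf f0.
have dom := normal_prob_dominates m s.
have mf : measurable_fun setT (EFin \o f : measurableTypeR R -> \bar R).
  by apply/measurable_EFinP; exact: continuous_measurable_fun.
have mpdf : measurable_fun setT (EFin \o normal_pdf m s).
  by apply/measurable_EFinP; exact: measurable_normal_pdf.
have iRN := Radon_Nikodym_SigmaFinite.f_integrable dom.
have mRN := measurable_int _ iRN.
rewrite -(Radon_Nikodym_SigmaFinite.change_of_variables dom)//.
under [RHS]eq_integral do rewrite EFinM.
apply: ae_eq_integral => //.
- exact: emeasurable_funM.
- exact: emeasurable_funM.
apply: ae_eqe_mul2l; apply: integral_ae_eq => // A _ mA.
by rewrite -Radon_Nikodym_SigmaFinite.f_integral.
Qed.

Lemma ge0_integral_normal_prob_affine (m s : R) (f : R -> R) : 0 < s ->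
  continuous f -> (forall x, 0 <= f x) ->
  (\int[normal_prob m s]_x (f x)%:E = \int[gauss]_x (f (s * x + m))%:E)%E.
Proof.
move=> s0 cf f0; rewrite !ge0_integral_normal_prob//; last first.
  exact: continuous_comp_affine.
rewrite (@ge0_integral_affine _ _ s m)//.
- by apply: eq_integral => x _; rewrite -mulrA normal_pdf_affine.
- move=> x; apply: cvgM; first exact: cf.
  by apply: continuous_normal_pdf; rewrite gt_eqF.
- by move=> x; rewrite mulr_ge0// normal_pdf_ge0.
Qed.

Lemma normal_pdfN x : phi (- x) = phi x.
Proof. by rewrite !normal_pdfE// /normal_fun !subr0 sqrrN. Qed.

Lemma ge0_integral_gauss_opp (f : R -> R) : continuous f -> (forall x, 0 <= f x) ->
  (\int[gauss]_x (f (- x))%:E = \int[gauss]_x (f x)%:E)%E.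
Proof.
move=> cf f0; rewrite !ge0_integral_normal_prob//; last first.
  by move=> x; apply: (@continuous_comp _ _ _ -%R f); [exact: opp_continuous|exact: cf].
rewrite -[RHS]ge0_integral_opp.
- by apply: eq_integral => x _; rewrite normal_pdfN.
- by move=> x; apply: cvgM; [exact: cf|exact: continuous_normal_pdf].
- by move=> x; rewrite mulr_ge0// normal_pdf_ge0.
Qed.

(* Its value is 1, but only its positivity is needed. *)
Definition gauss_sqr : R := fine (\int[gauss]_x (x ^+ 2)%:E)%E.

Let csqr : continuous (fun x : R => x ^+ 2). Proof. exact: exprn_continuous. Qed.

Lemma gauss_sqr_has_integral : has_integral gauss setT (fun x => x ^+ 2) gauss_sqr.
Proof.
apply: has_integral_ge0.
- exact: continuous_measurable_fun.
- by move=> x; exact: sqr_ge0.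
rewrite /gauss_sqr fineK// ge0_fin_numE; last first.
  by apply: integral_ge0 => x _; rewrite lee_fin sqr_ge0.
rewrite ge0_integral_normal_prob//; last by move=> x; exact: sqr_ge0.
(* Doubling the variance leaves a spare factor exp(-x^2/4), which controls x^2 because x^2 <= 4
   exp(x^2/4); K collects this 4 and the ratio of the normalizing constants. *)
pose s : R := Num.sqrt 2.
have s0 : 0 < s by rewrite sqrtr_gt0.
pose K : R := 4 * normal_peak 1 / normal_peak s.
have K0 : 0 <= K by rewrite divr_ge0 ?mulr_ge0 ?normal_peak_ge0.
apply: (@le_lt_trans _ _ (\int[mu]_x (K * normal_pdf 0 s x)%:E)%E).
  apply: ge0_le_integral => //.
  - by move=> x _; rewrite lee_fin mulr_ge0 ?sqr_ge0 ?normal_pdf_ge0.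
  - apply/measurable_EFinP; apply: measurable_funM => //.
    exact: measurable_normal_pdf.
  - apply/measurable_EFinP; apply: measurable_funM => //.
    exact: measurable_normal_pdf.
  move=> x _; rewrite lee_fin !normal_pdfE ?gt_eqF// /normal_fun !subr0 expr1n.
  rewrite /K mulrA [X in _ <= X](_ : _ = 4 * normal_peak 1 *
     expR (- x ^+ 2 / (s ^+ 2 *+ 2))); last first.
    by rewrite -!mulrA mulKf// gt_eqF// normal_peak_gt0// gt_eqF.
  rewrite sqr_sqrtr//
    (_ : - x ^+ 2 / (1 *+ 2) = - x ^+ 2 / (2 *+ 2) + - x ^+ 2 / (2 *+ 2)); last by field.
  rewrite expRD (_ : x ^+ 2 * _ * _ = (x ^+ 2 * expR (- x ^+ 2 / (2 *+ 2))) *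
    (normal_peak 1 * expR (- x ^+ 2 / (2 *+ 2)))); last by ring.
  rewrite -[leRHS]mulrA ler_wpM2r ?mulr_ge0 ?normal_peak_ge0 ?expR_ge0//.
  set u := x ^+ 2.
  rewrite mulNr expRN ler_pdivrMr ?expR_gt0//.
  have := expR_ge1Dx (u / (2 *+ 2)).
  rewrite (_ : 2 *+ 2 = 4); last by ring.
  have : 0 <= u by exact: sqr_ge0. lra.
under eq_integral do rewrite EFinM.
rewrite ge0_integralZl//.
- by rewrite integral_normal_pdf mule1 ltry.
- by apply/measurable_EFinP; exact: measurable_normal_pdf.
- by move=> x _; rewrite lee_fin normal_pdf_ge0.
Qed.

Lemma gauss_sqr_gt0 : 0 < gauss_sqr.
Proof.
have [_ <-] := gauss_sqr_has_integral.
have [iq _] := gauss_sqr_has_integral.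
rewrite -lte_fin [X in (_ < X)%E](_ : _ = \int[gauss]_x (x ^+ 2)%:E)%E; last first.
  by rewrite /Rintegral fineK//; exact: integrable_fin_num iq.
rewrite ge0_integral_normal_prob//; last by move=> x; exact: sqr_ge0.
have mp : measurable_fun [set: R] (fun x : R => x ^+ 2 * phi x).
  by apply: measurable_funM => //; exact: measurable_normal_pdf.
have q0 x : 0 <= x ^+ 2 * phi x by rewrite mulr_ge0 ?sqr_ge0 ?normal_pdf_ge0.
apply: (@lt_le_trans _ _ (\int[mu]_(x in `[1%R, 2%R]) (phi 2)%:E)%E).
  rewrite integral_cst//= lebesgue_measure_itv/= lte_fin ltr1n/= -EFinB -EFinM lte_fin.
  by rewrite mulr_gt0// ?normal_pdfE// ?mulr_gt0 ?normal_peak_gt0 ?expR_gt0//; lra.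
apply: (@le_trans _ _ (\int[mu]_(x in `[1%R, 2%R]) (x ^+ 2 * phi x)%:E)%E).
  apply: ge0_le_integral => //.
  - by move=> x _; rewrite lee_fin normal_pdf_ge0.
  - exact/measurable_EFinP/measurable_funTS.
  move=> x /=; rewrite in_itv/= => /andP[x1 x2]; rewrite lee_fin.
  have : phi 2 <= phi x.
    rewrite !normal_pdfE// ler_pM2l ?normal_peak_gt0// ler_expR !subr0.
    by rewrite ler_pM2r ?invr_gt0// lerN2 ler_sqr ?nnegrE//; lra.
  have : 1 <= x ^+ 2 by rewrite exprn_ege1.
  have := normal_pdf_ge0 0 1 x; set a := phi x; set b := phi 2; nra.
apply: ge0_subset_integral => //.
- exact/measurable_EFinP.
- by move=> x _; rewrite lee_fin.
Qed.

End std_gaussian.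

Section bounded.
Context {R : realType} d (Om : measurableType d) (P : probability Om R).

Lemma bounded_has_integral (f : Om -> R) M : measurable_fun setT f ->
  (forall w, `|f w| <= M) -> has_integral P setT f (\int[P]_w f w).
Proof.
move=> mf fM; split => //; apply: measurable_bounded_integrable => //.
  by rewrite (le_lt_trans (probability_le1 _ _))// ltry.
exists M; split; first exact: num_real.
by move=> y My w _ /=; rewrite (le_trans (fM w))// ltW.
Qed.

Lemma has_integral_prob_cst (a : R) : has_integral P setT (fun=> a) a.
Proof.
have [H _] := @bounded_has_integral (fun=> a) `|a| (measurable_cst _) (fun=> lexx _).
by split => //; rewrite Rintegral_cst//= probability_setT mulr1.
Qed.

Lemma bounded_cvg_Rintegral (f_ : nat -> Om -> R) (f : Om -> R) M :
  (forall n, measurable_fun setT (f_ n)) -> measurable_fun setT f ->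
  (forall n w, `|f_ n w| <= M) ->
  {ae P, forall w, f_ n w @[n --> \oo] --> f w} ->
  \int[P]_w f_ n w @[n --> \oo] --> \int[P]_w f w.
Proof.
move=> mf_ mf fM ff.
have [] := @dominated_convergence _ _ R P setT measurableT
    (fun n w => (f_ n w)%:E) (fun w => (f w)%:E) (fun=> M%:E).
- by move=> n; exact/measurable_EFinP.
- exact/measurable_EFinP.
- apply: filterS ff => w fw _; apply/fine_cvgP; split; first by near=> n.
  exact: fw.
- by have [] := has_integral_prob_cst M.
- by apply: aeW => w n _; rewrite /= lee_fin.
move=> iu _ h; apply: fine_cvg.
by rewrite fineK//; exact: integrable_fin_num.
Unshelve. all: by end_near. Qed.

End bounded.

Section gaussian_law.
Context {R : realType}.
Notation mu := (@lebesgue_measure R).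
Notation g := (@gauss R).

Lemma gauss_id_has_integral : has_integral g setT (fun x => x) 0.
Proof.
have [iq _] := @gauss_sqr_has_integral R.
have [i1 _] := has_integral_prob_cst g (1 : R).
have idi : g.-integrable setT (EFin \o (fun x : R => x)).
  apply: (le_integrable measurableT _ _ (integrableD measurableT i1 iq)).
    by apply/measurable_EFinP; exact: measurable_id.
  move=> x _; rewrite -[leRHS]/(`|1 + x ^+ 2|%:E) lee_fin.
  rewrite [leRHS]ger0_norm ?addr_ge0 ?sqr_ge0//.
  rewrite -(real_normK (num_real x)); move: `|x| => y.
  by have := sqr_ge0 (y - 1 / 2); nra.
split=> //.
(* The symmetry of the law is available for nonnegative functions, so the identity is written as f x
   - f (- x) and the two parts cancel. *)
pose f (x : R) := Num.max x 0.
have cf : continuous f.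
  move=> x; apply: (@continuous_max _ _ (fun x : R => x) (fun=> 0)).
    exact: cvg_id.
  exact: cvg_cst.
have f0 x : 0 <= f x by rewrite /f le_max lexx orbT.
have fb x : `|f x| <= `|x|.
  by rewrite ger0_norm// /f ge_max ler_norm normr_ge0.
have fi : g.-integrable setT (EFin \o f).
  apply: (le_integrable measurableT _ _ idi).
    by apply/measurable_EFinP; exact: continuous_measurable_fun.
  by move=> x _; rewrite lee_fin.
have cfN : continuous (f \o -%R).
  by move=> x; apply: continuous_comp; [exact: opp_continuous|exact: cf].
have fiN : g.-integrable setT (EFin \o (f \o -%R)).
  apply: (le_integrable measurableT _ _ idi).
    by apply/measurable_EFinP; exact: continuous_measurable_fun.
  by move=> x _; rewrite lee_fin (le_trans (fb _))// normrN.
rewrite (_ : \int[g]_x x = \int[g]_x (f x - f (- x))).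
  rewrite RintegralB//; apply/eqP; rewrite subr_eq0; apply/eqP.
  by rewrite /Rintegral ge0_integral_gauss_opp.
apply: eq_Rintegral => x _; rewrite /f.
have [x0|x0] := leP 0 x; first by rewrite max_r ?subr0// oppr_le0.
by rewrite max_l ?oppr_ge0 ?ltW// sub0r opprK.
Qed.

Lemma ge0_integral_law d (Om : measurableType d) (P : probability Om R) (Y : Om -> R)
    (mY : measurable_fun setT Y) (nu : {measure set (measurableTypeR R) -> \bar R})
    (f : R -> R) :
  (forall A, measurable A -> P (Y @^-1` A) = nu A) ->
  measurable_fun setT (fun x : measurableTypeR R => (f x)%:E) -> (forall x, 0 <= f x) ->
  (\int[P]_w (f (Y w))%:E = \int[nu]_x (f x)%:E)%E.
Proof.
move=> PY mf f0.
pose mX := isMeasurableFun.Build _ _ Om (measurableTypeR R) Y mY.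
pose X : {RV P >-> measurableTypeR R} := HB.pack Y mX.
rewrite [RHS](eq_measure_integral (distribution P X)).
  by rewrite ge0_integral_distribution// => x; rewrite lee_fin.
by move=> A mA _; exact/esym/PY.
Qed.

(** Presenting the law as the image of [gauss] under z |-> s z + m treats the degenerate case s = 0
    together with the others. Nonnegative f come first, then positive and negative parts. *)
Lemma gaussian_law d (Om : measurableType d) (P : probability Om R) (Y : Om -> R) :
  is_gaussian P Y -> exists m s : R, 0 <= s /\
  forall (f : R -> R) v, continuous f ->
    has_integral g setT (fun z => f (s * z + m)) v ->
    has_integral P setT (fun w => f (Y w)) v.
Proof.
move=> [mY [m [s [s0 PY]]]]; exists m, s; split => //.
have pos (f : R -> R) v : continuous f -> (forall x, 0 <= f x) ->
    has_integral g setT (fun z => f (s * z + m)) v ->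
    has_integral P setT (fun w => f (Y w)) v.
  move=> cf f0 [ig <-].
  have mf : measurable_fun [set: R] f by exact: continuous_measurable_fun.
  apply: has_integral_ge0 => //; first exact: measurableT_comp.
  rewrite /Rintegral fineK; last exact: integrable_fin_num.
  have mfE : measurable_fun setT (fun x : measurableTypeR R => (f x)%:E).
    exact/measurable_EFinP.
  have [s_eq0|s_neq0] := eqVneq s 0.
    transitivity (f m)%:E; last first.
      rewrite s_eq0; under eq_integral do rewrite mul0r add0r.
      by rewrite integral_cst//= probability_setT mule1.
    have D := @integral_dirac _ (measurableTypeR R) m R _ measurableT _ mfE.
    rewrite diracT mul1e in D; rewrite -D.
    apply: (@ge0_integral_law _ _ P Y mY (@dirac _ (measurableTypeR R) m R)) => // A mA.
    by apply: (etrans (PY A mA)); rewrite s_eq0 eqxx.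
  rewrite -ge0_integral_normal_prob_affine ?lt_neqAle ?s0 1?eq_sym ?s_neq0//.
  apply: (@ge0_integral_law _ _ P Y mY (normal_prob m s)) => // A mA.
  by apply: (etrans (PY A mA)); rewrite (negbTE s_neq0).
move=> f v cf [ig iv].
pose fp x := Num.max (f x) 0; pose fn x := Num.max (- f x) 0.
have cfp : continuous fp.
  move=> x; apply: (@continuous_max _ _ f (fun=> 0)); first exact: cf.
  exact: cvg_cst.
have cfn : continuous fn.
  move=> x; apply: (@continuous_max _ _ (fun x => - f x) (fun=> 0)); last exact: cvg_cst.
  by apply: cvgN; exact: cf.
have fp0 x : 0 <= fp x by rewrite /fp le_max lexx orbT.
have fn0 x : 0 <= fn x by rewrite /fn le_max lexx orbT.
have fE x : f x = fp x - fn x.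
  rewrite /fp /fn; have [x0|x0] := leP 0 (f x); first by rewrite max_r ?subr0// oppr_le0.
  by rewrite max_l ?oppr_ge0 ?ltW// sub0r opprK.
have int h : continuous h -> (forall x, `|h x| <= `|f x|) ->
    has_integral g setT (fun z => h (s * z + m)) (\int[g]_z h (s * z + m)).
  move=> ch hf; split => //; apply: (le_integrable measurableT _ _ ig).
    by apply/measurable_EFinP; apply: continuous_measurable_fun; exact: continuous_comp_affine.
  by move=> x _; rewrite lee_fin.
have ip : has_integral g setT (fun z => fp (s * z + m)) (\int[g]_z fp (s * z + m)).
  by apply: int => // x; rewrite ger0_norm// /fp ge_max ler_norm normr_ge0.
have in_ : has_integral g setT (fun z => fn (s * z + m)) (\int[g]_z fn (s * z + m)).
  by apply: int => // x; rewrite ger0_norm// /fn ge_max -normrN ler_norm normr_ge0.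
have -> : (fun w => f (Y w)) = (fun w => fp (Y w) - fn (Y w)).
  by apply/funext => w.
have -> : v = \int[g]_z fp (s * z + m) - \int[g]_z fn (s * z + m).
  have [_ <-] := has_integralB measurableT ip in_.
  by rewrite -iv; apply: eq_Rintegral => x _.
by apply: has_integralB => //; exact: pos.
Qed.

(** The characteristic function of the standard Gaussian law, real by symmetry. Its closed form is
    never computed: the functional equation [gauss_cosM] takes its place. *)
Definition gauss_cos (s : R) : R := \int[g]_z cos (s * z).

Lemma gauss_cosN s : gauss_cos (- s) = gauss_cos s.
Proof. by apply: eq_Rintegral => z _; rewrite mulNr cosN. Qed.

Lemma gauss_cos0 : gauss_cos 0 = 1.
Proof.
rewrite /gauss_cos; under eq_Rintegral do rewrite mul0r cos0.
by have [] := has_integral_prob_cst g (1 : R).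
Qed.

Let mcosaff (s theta : R) : measurable_fun [set: R] (fun z => cos (s * z + theta)).
Proof.
by apply: continuous_measurable_fun; apply: continuous_comp_affine; exact: continuous_cos.
Qed.

Lemma gauss_cos_has_integral s theta :
  has_integral g setT (fun z => cos (s * z + theta)) (cos theta * gauss_cos s).
Proof.
have I1 th : has_integral g setT (fun z => cos (s * z + th))
    (\int[g]_z cos (s * z + th)).
  apply: (@bounded_has_integral _ _ _ _ _ 1); first exact: mcosaff.
  by move=> w; exact: cos_max.
have sym th : \int[g]_z cos (s * z + th) = \int[g]_z cos (s * z - th).
  (* Adding 1 makes the cosine nonnegative, so that the reflection z |-> -z can be applied. *)
  pose f z := 1 + cos (s * z + th).
  have cf : continuous f.
    move=> x; apply: cvgD; first exact: cvg_cst.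
    by apply: continuous_comp_affine; exact: continuous_cos.
  have f0 z : 0 <= f z by rewrite /f; have := cos_geN1 (s * z + th); lra.
  have [_ e1] := has_integralD measurableT (has_integral_prob_cst g (1 : R)) (I1 th).
  have [_ e2] := has_integralD measurableT (has_integral_prob_cst g (1 : R)) (I1 (- th)).
  apply: (@addrI _ 1); rewrite -e1 -e2.
  transitivity (\int[g]_z f (- z)).
    by rewrite /Rintegral ge0_integral_gauss_opp.
  apply: eq_Rintegral => z _; rewrite /f -cosN; congr (_ + cos _); ring.
have [ip ep] := I1 theta; split => //.
have [_ e] := has_integralD measurableT (I1 theta) (I1 (- theta)).
have : 2 * \int[g]_z cos (s * z + theta) = 2 * (cos theta * gauss_cos s).
  rewrite mulr_natl mulr2n {2}sym -e mulrA.
  have I0 : has_integral g setT (fun z => cos (s * z)) (gauss_cos s).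
    apply: (@bounded_has_integral _ _ _ _ _ 1).
      by have := mcosaff s 0; under eq_fun do rewrite addr0.
    by move=> w; exact: cos_max.
  have [_ <-] := has_integralZ (2 * cos theta) measurableT I0.
  by apply: eq_Rintegral => z _; rewrite cosD cosB; ring.
by apply: mulfI.
Qed.

Lemma cvg_gauss_cos (s_ : nat -> R) s : s_ n @[n --> \oo] --> s ->
  gauss_cos (s_ n) @[n --> \oo] --> gauss_cos s.
Proof.
move=> ss; apply: (@bounded_cvg_Rintegral _ _ _ g
  (fun n z => cos (s_ n * z)) (fun z => cos (s * z)) 1).
- by move=> n; have := mcosaff (s_ n) 0; under eq_fun do rewrite addr0.
- by have := mcosaff s 0; under eq_fun do rewrite addr0.
- by move=> n w; exact: cos_max.
- apply: aeW => z; apply: (@cvg_comp _ _ _ (fun n => s_ n * z) cos).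
    by apply: cvgM; [exact: ss|exact: cvg_cst].
  exact: continuous_cos.
Qed.

End gaussian_law.

(** * Multiplicativity of the Gaussian cosine transform *)

Section convolution.
Context {R : realType}.
Notation mu := (@lebesgue_measure R).
Notation g := (@gauss R).
Notation phi := (normal_pdf (0 : R) 1).

Lemma normal_pdf_rotation (a b u v : R) : a ^+ 2 + b ^+ 2 = u ^+ 2 + v ^+ 2 ->
  phi a * phi b = phi u * phi v.
Proof.
move=> e; rewrite !normal_pdfE// /normal_fun !subr0 !expr1n.
rewrite mulrACA [RHS]mulrACA -!expRD; congr (_ * expR _).
move: (a ^+ 2) (b ^+ 2) (u ^+ 2) (v ^+ 2) (1 *+ 2)^-1 e => A B U V c e.
by rewrite (_ : A = U + V - B); [ring|rewrite -e; ring].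
Qed.

(** The shift by 1 gives a nonnegative integrand, to which Tonelli and the changes of variables
    apply. *)
Let F (x : R) := 1 + cos x.

Let F0 x : 0 <= F x. Proof. by rewrite /F; have := cos_geN1 x; lra. Qed.

Let cF : continuous F.
Proof. by move=> x; apply: cvgD; [exact: cvg_cst|exact: continuous_cos]. Qed.

Let phi0 x : 0 <= phi x := normal_pdf_ge0 0 1 x.

Let cphi : continuous phi. Proof. exact: continuous_normal_pdf. Qed.

Let gF t th : (\int[mu]_y (F (t * y + th) * phi y)%:E = (1 + cos th * gauss_cos t)%:E)%E.
Proof.
rewrite -ge0_integral_normal_prob//; last exact: continuous_comp_affine.
have [ih hv] := has_integralD measurableT (has_integral_prob_cst g (1 : R))
  (gauss_cos_has_integral t th).
by rewrite -hv /Rintegral fineK//; exact: integrable_fin_num ih.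
Qed.

Let gauss_cos_le1 (t : R) : `|gauss_cos t| <= 1.
Proof.
have cM : measurable_fun [set: R] (fun z => cos (t * z)).
  have := continuous_comp_affine (a := t) (b := 0) (@continuous_cos R).
  by under eq_fun do rewrite addr0; exact: continuous_measurable_fun.
have [i1 _] := has_integral_prob_cst g (1 : R).
have [ic _] : has_integral g setT (fun z => cos (t * z)) (gauss_cos t).
  by apply: (@bounded_has_integral _ _ _ _ _ 1) => // w; exact: cos_max.
have [icn _] : has_integral g setT (fun z => `|cos (t * z)|) (\int[g]_z `|cos (t * z)|).
  apply: (@bounded_has_integral _ _ _ _ _ 1); first exact: measurableT_comp.
  by move=> w; rewrite normr_id; exact: cos_max.
apply: (le_trans (le_normr_Rintegral _ _)) => //.
have [_ <-] := has_integral_prob_cst g (1 : R).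
by apply: le_Rintegral => // x _; exact: cos_max.
Qed.

(* Convolution of two Gaussian densities, through the rotation invariance of
   their product. *)
Lemma gauss_cosM (s t : R) : 0 < s -> 0 < t ->
  gauss_cos s * gauss_cos t = gauss_cos (Num.sqrt (s ^+ 2 + t ^+ 2)).
Proof.
move=> s0 t0; set r := Num.sqrt _.
have r2 : r ^+ 2 = s ^+ 2 + t ^+ 2 by rewrite sqr_sqrtr// addr_ge0// sqr_ge0.
have r0 : 0 < r by rewrite sqrtr_gt0 addr_gt0// exprn_gt0.
suff: ((1 + gauss_cos s * gauss_cos t)%:E = (1 + gauss_cos r)%:E)%E by case=> /addrI.
transitivity (\int[mu]_x \int[mu]_w (F w * (phi ((w - s * x) / t) * phi x / t))%:E)%E.
  transitivity (\int[mu]_x ((1 + cos (s * x) * gauss_cos t) * phi x)%:E)%E.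
    rewrite -ge0_integral_normal_prob//; last 2 first.
    - move=> x; apply: cvgD; first exact: cvg_cst.
      apply: cvgM; last exact: cvg_cst.
      have := continuous_comp_affine (a := s) (b := 0) (@continuous_cos R).
      by under eq_fun do rewrite addr0; apply.
    - move=> x; have := gauss_cos_le1 t; have := cos_max (s * x).
      by rewrite !ler_norml => /andP[? ?] /andP[? ?]; nra.
    have hs := gauss_cos_has_integral s 0.
    rewrite cos0 mul1r in hs.
    have [ih hv] := has_integralD measurableT (has_integral_prob_cst g (1 : R))
      (has_integralZ (gauss_cos t) measurableT hs).
    rewrite (mulrC (gauss_cos s)) -hv /Rintegral fineK; last exact: integrable_fin_num ih.
    by apply: eq_integral => x _; rewrite addr0 mulrC.
  apply: eq_integral => x _.
  transitivity (phi x * (1 + cos (s * x) * gauss_cos t))%:E; first by rewrite mulrC.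
  rewrite EFinM -gF -ge0_integralZl//=; last 3 first.
  - apply/measurable_EFinP; apply: measurable_funM; last exact: measurable_normal_pdf.
    by apply: continuous_measurable_fun; exact: continuous_comp_affine.
  - by move=> y _; rewrite lee_fin mulr_ge0.
  - by rewrite lee_fin.
  under eq_integral do rewrite -EFinM.
  rewrite (@ge0_integral_affine _ _ t^-1 (- (s * x / t))) ?invr_gt0//; last 2 first.
  - move=> y; apply: cvgM; first exact: cvg_cst.
    by apply: cvgM; [exact: continuous_comp_affine|exact: cphi].
  - by move=> y; rewrite !mulr_ge0.
  apply: eq_integral => w _; congr EFin.
  rewrite (_ : t * _ + _ = w); last by field; rewrite gt_eqF.
  rewrite (_ : t^-1 * w - _ = (w - s * x) / t); last by field; rewrite gt_eqF.
  by ring.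
have mK : measurable_fun [set: measurableTypeR R * measurableTypeR R]
    (fun z : R * R => F z.2 * (phi ((z.2 - s * z.1) / t) * phi z.1 / t)).
  have m1 : measurable_fun [set: measurableTypeR R * measurableTypeR R] (fst : _ -> R).
    exact: measurable_fst.
  have m2 : measurable_fun [set: measurableTypeR R * measurableTypeR R] (snd : _ -> R).
    exact: measurable_snd.
  apply: measurable_funM.
    by apply: (measurableT_comp (continuous_measurable_fun cF)).
  apply: measurable_funM => //; apply: measurable_funM; last first.
    exact: (measurableT_comp (measurable_normal_pdf 0 1)).
  apply: (measurableT_comp (measurable_normal_pdf 0 1)).
  apply: measurable_funM => //; apply: measurable_funB => //.
  exact: measurable_funM.
rewrite (@fubini_tonelli _ _ (measurableTypeR R) (measurableTypeR R) R mu mu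
  (fun z => (F z.2 * (phi ((z.2 - s * z.1) / t) * phi z.1 / t))%:E))/=; last 2 first.
- exact/measurable_EFinP.
- by move=> z; rewrite lee_fin !mulr_ge0// invr_ge0 ltW.
transitivity (\int[mu]_w (F w * (phi (w / r) / r))%:E)%E.
  apply: eq_integral => w _.
  (* Completing the square: with x = (t/r) u + s w / r^2 one has ((w - s x)/t)^2 + x^2 = (w/r)^2 +
     u^2, so u separates and integrates to 1. *)
  rewrite (@ge0_integral_affine _ _ (t / r) (s * w / r ^+ 2)) ?divr_gt0//; last 2 first.
  - move=> x; apply: cvgM; first exact: cvg_cst.
    apply: cvgM; last exact: cvg_cst.
    apply: cvgM; last exact: cphi.
    apply: (@continuous_comp _ _ _ (fun x => (w - s * x) / t) phi); last exact: cphi.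
    apply: cvgM; last exact: cvg_cst.
    by apply: cvgB; [exact: cvg_cst|exact: mulrl_continuous].
  - by move=> x; rewrite !mulr_ge0// invr_ge0 ltW.
  transitivity (\int[mu]_u ((F w * (phi (w / r) / r))%:E * (phi u)%:E))%E.
    apply: eq_integral => u _; rewrite -EFinM; congr EFin.
    set x := t / r * u + _.
    rewrite (@normal_pdf_rotation _ _ (w / r) u); last first.
      rewrite /x.
      rewrite (_ : w - s * _ = (t ^+ 2) * w / r ^+ 2 - s * t * u / r); last first.
        apply: (@mulIf _ (r ^+ 2)); first by rewrite gt_eqF// exprn_gt0.
        rewrite (_ : (w - _) * _ = w * r ^+ 2 - s ^+ 2 * w - s * t * u * r); last first.
          by field; rewrite gt_eqF.
        rewrite {1}r2 (_ : _ * r ^+ 2 = t ^+ 2 * w - s * t * u * r); last first.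
          by field; rewrite gt_eqF.
        by ring.
      apply: (@mulIf _ (r ^+ 4)); first by rewrite gt_eqF// exprn_gt0.
      rewrite [RHS](_ : _ = w ^+ 2 * r ^+ 2 + u ^+ 2 * (r ^+ 2) ^+ 2); last first.
        by field; rewrite gt_eqF.
      rewrite (_ : _ * r ^+ 4 = (w ^+ 2 + u ^+ 2 * r ^+ 2) * (s ^+ 2 + t ^+ 2)); last first.
        by field; rewrite !gt_eqF.
      by rewrite -r2; ring.
    by field; rewrite !gt_eqF.
  rewrite ge0_integralZl//=.
  - by rewrite integral_normal_pdf mule1.
  - by apply/measurable_EFinP; exact: measurable_normal_pdf.
  - by move=> u _; rewrite lee_fin.
  - by rewrite lee_fin !mulr_ge0// invr_ge0 ltW.
rewrite (@ge0_integral_affine _ _ r 0)//; last 2 first.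
- move=> w; apply: cvgM; first exact: cF.
  apply: cvgM; last exact: cvg_cst.
  apply: (@continuous_comp _ _ _ (fun w : R => w / r) phi); last exact: cphi.
  by apply: cvgM; [exact: cvg_id|exact: cvg_cst].
- by move=> w; rewrite !mulr_ge0// invr_ge0 ltW.
have := gF r 0; rewrite cos0 mul1r => <-.
apply: eq_integral => w _; congr EFin.
rewrite addr0 (_ : r * w / r = w); last by field; rewrite gt_eqF.
by field; rewrite gt_eqF.
Qed.

End convolution.

Section gaussian_cos.
Context {R : realType}.
Notation g := (@gauss R).
Notation kappa := (@gauss_sqr R).

(** The cosine transform at 1 of a centered Gaussian law of variance V; [kappa] is the variance of
    [gauss]. *)
Definition gauss_char (V : R) : R := gauss_cos (Num.sqrt (V / kappa)).

Lemma gauss_charD a b : 0 <= a -> 0 <= b ->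
  gauss_char a * gauss_char b = gauss_char (a + b).
Proof.
have k0 := @gauss_sqr_gt0 R.
rewrite le_eqVlt => /predU1P[<- _|a0].
  by rewrite /gauss_char mul0r sqrtr0 gauss_cos0 mul1r add0r.
rewrite le_eqVlt => /predU1P[<-|b0].
  by rewrite /gauss_char mul0r sqrtr0 gauss_cos0 mulr1 addr0.
rewrite /gauss_char gauss_cosM ?sqrtr_gt0 ?divr_gt0//.
by rewrite !sqr_sqrtr ?divr_ge0 ?ltW// -mulrDl.
Qed.

Lemma cvg_gauss_char (V_ : nat -> R) V : V_ n @[n --> \oo] --> V ->
  gauss_char (V_ n) @[n --> \oo] --> gauss_char V.
Proof.
move=> VV; apply: cvg_gauss_cos.
apply: (@cvg_comp _ _ _ (fun n => V_ n / kappa) Num.sqrt); last exact: sqrt_continuous.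
by apply: cvgM; [exact: VV|exact: cvg_cst].
Qed.

Section law.
Context d (Om : measurableType d) (P : probability Om R) (Y : Om -> R).
Hypothesis gY : is_gaussian P Y.

Let csqr : continuous (fun x : R => x ^+ 2). Proof. exact: exprn_continuous. Qed.

Let cid_ : continuous (fun x : R => x). Proof. by move=> x; exact: cvg_id. Qed.

Let affi (s m : R) : has_integral g setT (fun z => s * z + m) m.
Proof.
have := has_integralD measurableT
  (has_integralZ s measurableT (@gauss_id_has_integral R)) (has_integral_prob_cst g m).
by rewrite mulr0 add0r.
Qed.

Let affi2 (s m : R) : has_integral g setT (fun z => (s * z + m) ^+ 2)
  (s ^+ 2 * kappa + m ^+ 2).
Proof.
have h1 := has_integralZ (s ^+ 2) measurableT (@gauss_sqr_has_integral R).
have h2 := has_integralZ (2 * s * m) measurableT (@gauss_id_has_integral R).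
have := has_integralD measurableT (has_integralD measurableT h1 h2)
  (has_integral_prob_cst g (m ^+ 2)).
rewrite mulr0 addr0; congr has_integral.
by apply/funext => z; ring.
Qed.

Lemma gaussian_integrable : has_integral P setT Y (\int[P]_w Y w).
Proof.
have [m [s [s0 H]]] := gaussian_law gY.
have [iY _] := H (fun x => x) m cid_ (affi s m).
by split.
Qed.

Lemma gaussian_sqr_integrable :
  has_integral P setT (fun w => Y w ^+ 2) (\int[P]_w (Y w ^+ 2)).
Proof.
have [m [s [s0 H]]] := gaussian_law gY.
have [iY _] := H _ _ csqr (affi2 s m).
by split.
Qed.

Lemma gaussian_cos theta V : \int[P]_w Y w = 0 -> \int[P]_w (Y w ^+ 2) = V ->
  has_integral P setT (fun w => cos (Y w + theta)) (cos theta * gauss_char V).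
Proof.
move=> EY EY2; have [m [s [s0 H]]] := gaussian_law gY.
have [_ m0] := H (fun x => x) m cid_ (affi s m).
rewrite EY in m0; rewrite -{}m0 in H.
have [_ VE] := H _ _ csqr (affi2 s 0).
rewrite EY2 expr0n addr0 in VE.
have k0 := @gauss_sqr_gt0 R.
rewrite /gauss_char VE mulfK ?gt_eqF// sqrtr_sqr ger0_norm//.
apply: (H (fun x => cos (x + theta))).
  move=> x; apply: (@continuous_comp _ _ _ (fun x => x + theta) cos).
    by apply: cvgD; [exact: cvg_id|exact: cvg_cst].
  exact: continuous_cos.
by under eq_fun do rewrite addr0; exact: gauss_cos_has_integral.
Qed.

End law.
End gaussian_cos.

Section fbm_comb.
Context {R : realType} d (Om : measurableType d) (P : probability Om R).
Variables (H T : R) (B : R -> Om -> R).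
Hypothesis B_fbm : is_fbm P H T B.

Notation good c := (all (fun x : R * R => 0 <= x.2 <= T) c).

Definition comb (c : seq (R * R)) (w : Om) : R := \sum_(x <- c) x.1 * B x.2 w.

Lemma comb_gaussian c : good c -> is_gaussian P (comb c).
Proof.
move=> /allP gc; have [gB _ _] := B_fbm.
rewrite (_ : comb c = fun w => \sum_(i < size c) (nth (0, 0) c i).1 * B (nth (0, 0) c i).2 w).
  apply: (gB (size c) (fun i : 'I_(size c) => (nth (0, 0) c i).2)
    (fun i : 'I_(size c) => (nth (0, 0) c i).1)) => i.
  by rewrite /= in_itv/=; apply: gc; exact: mem_nth.
by apply/funext => w; rewrite /comb (big_nth (0, 0)) big_mkord.
Qed.

Let comb1 s : comb [:: (1, s)] = B s.
Proof. by apply/funext => w; rewrite /comb big_seq1 mul1r. Qed.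

Let gB s : 0 <= s <= T -> is_gaussian P (B s).
Proof. by move=> sT; rewrite -comb1; apply: comb_gaussian; rewrite /= sT. Qed.

Lemma fbm_mean s : 0 <= s <= T -> has_integral P setT (B s) 0.
Proof.
move=> sT; have [_ EB _] := B_fbm.
have [iB _] := gaussian_integrable (gB sT).
split => //; have := EB s; rewrite in_itv/= sT => /(_ isT).
by rewrite unlock => e; rewrite /Rintegral e.
Qed.

Lemma fbm_cov_has_integral s t : 0 <= s <= T -> 0 <= t <= T ->
  has_integral P setT (fun w => B s w * B t w) (fbm_cov H s t).
Proof.
move=> sT tT; have [_ EB CB] := B_fbm.
have ms : measurable_fun setT (B s) by case: (gB sT).
have mt : measurable_fun setT (B t) by case: (gB tT).
split.
  have [i1 _] := gaussian_sqr_integrable (gB sT).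
  have [i2 _] := gaussian_sqr_integrable (gB tT).
  apply: (le_integrable measurableT _ _ (integrableD measurableT i1 i2)).
    by apply/measurable_EFinP; exact: measurable_funM.
  move=> w _; rewrite -[leRHS]/(`|B s w ^+ 2 + B t w ^+ 2|%:E) lee_fin.
  rewrite [leRHS]ger0_norm ?addr_ge0 ?sqr_ge0// normrM.
  rewrite -(real_normK (num_real (B s w))) -(real_normK (num_real (B t w))).
  move: (`|B s w|) (`|B t w|) => x y.
  by have := sqr_ge0 (x - y); have := sqr_ge0 (x + y); lra.
have Es := EB s; rewrite in_itv/= sT in Es.
have Et := EB t; rewrite in_itv/= tT in Et.
have := CB s t; rewrite !in_itv/= sT tT => /(_ isT isT).
rewrite covariance.unlock (Es isT) (Et isT) expectation.unlock /= => e.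
rewrite /Rintegral -[RHS]/(fine (fbm_cov H s t)%:E) -e; congr fine.
apply: eq_integral => w _; congr EFin.
by rewrite -[RHS]/((B s w - 0) * (B t w - 0)) !subr0.
Qed.

Lemma comb_sqr c : good c ->
  has_integral P setT (fun w => comb c w ^+ 2) (fbm_ip H c c).
Proof.
move=> /allP gc'.
rewrite (_ : (fun w => _) = (fun w => \sum_(x <- c) \sum_(y <- c)
    (x.1 * y.1) * (B x.2 w * B y.2 w))); last first.
  apply/funext => w; rewrite expr2 mulr_suml; apply: eq_bigr => x _.
  by rewrite mulr_sumr; apply: eq_bigr => y _; ring.
apply: has_integral_sum => // x xc; apply: has_integral_sum => // y yc.
by apply: has_integralZ => //; apply: fbm_cov_has_integral; exact: gc'.
Qed.

Lemma comb_cos c theta : good c ->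
  has_integral P setT (fun w => cos (comb c w + theta)) (cos theta * gauss_char (fbm_ip H c c)).
Proof.
move=> gc; have /allP gc' := gc; apply: gaussian_cos; first exact: comb_gaussian.
  have [_ ->] : has_integral P setT (comb c) (\sum_(x <- c) x.1 * 0).
    by apply: has_integral_sum => // x xc; apply: has_integralZ => //; exact/fbm_mean/gc'.
  by rewrite big1// => x _; rewrite mulr0.
by case: (comb_sqr gc).
Qed.

Lemma fbm_ip_ge0 c : good c -> 0 <= fbm_ip H c c.
Proof.
move=> gc; have [_ <-] := comb_sqr gc.
by apply: Rintegral_ge0 => w _; exact: sqr_ge0.
Qed.

End fbm_comb.

Section ae_limit.
Context {R : realType} d (Om : measurableType d) (P : probability Om R).

(** With z = 1/2, the inequality D <= z^n + z^(-n) D^2 turns the L2 rate into E D <= 2 z^n. The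
    increments are then summable in L1, so their sum is almost everywhere finite and X n
    converges. *)
Lemma ae_cvg_fast_L2 (X : nat -> Om -> R) :
  (forall n, measurable_fun setT (X n)) ->
  (forall n, exists2 v, v <= ((2^-1) ^+ n) ^+ 2 &
     has_integral P setT (fun w => (X n.+1 w - X n w) ^+ 2) v) ->
  exists2 Z : Om -> R, measurable_fun setT Z &
    {ae P, forall w, X n w @[n --> \oo] --> Z w}.
Proof.
move=> mX X2; pose z : R := 2^-1.
have zn n : 0 < z ^+ n by rewrite exprn_gt0// invr_gt0.
pose D n w := `|X n.+1 w - X n w|.
have D0 n w : 0 <= D n w by exact: normr_ge0.
have mD n : measurable_fun setT (D n).
  by apply: measurableT_comp => //; exact: measurable_funB.
have ID n : (\int[P]_w (D n w)%:E <= (2 * z ^+ n)%:E)%E.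
  have [v vz hv] := X2 n.
  have h := has_integralD measurableT (has_integral_prob_cst P (z ^+ n))
    (has_integralZ (z ^+ n)^-1 measurableT hv).
  apply: (@le_trans _ _ (\int[P]_w (z ^+ n + (z ^+ n)^-1 * (X n.+1 w - X n w) ^+ 2)%:E)%E).
    apply: ge0_le_integral => //.
    - by move=> w _; rewrite lee_fin.
    - exact/measurable_EFinP.
    - by case: h => /integrableP[].
    move=> w _; rewrite lee_fin /D -(real_normK (num_real (X n.+1 w - X n w))).
    rewrite -(ler_pM2l (zn n)) mulrDr mulVKf ?gt_eqF//.
    move: (z ^+ n) `|_| (normr_ge0 (X n.+1 w - X n w)) => a y y0.
    by have := sqr_ge0 (a - y); have := sqr_ge0 (a + y); nra.
  case: h => ih hE.
  rewrite -[leLHS]fineK; last exact: integrable_fin_num ih.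
  rewrite -/(Rintegral _ _ _) hE lee_fin mulr_natl mulr2n lerD2l.
  rewrite -(ler_pM2l (zn n)) mulVKf ?gt_eqF// -expr2; exact: vz.
have geo m : \sum_(0 <= i < m) 2 * z ^+ i = 4 * (1 - z ^+ m).
  elim: m => [|m IH]; first by rewrite big_geq// expr0 subrr mulr0.
  by rewrite big_nat_recr//= IH exprS /z; field.
pose S w := (\sum_(0 <= n <oo) (D n w)%:E)%E.
have IS : (\int[P]_w S w < +oo)%E.
  rewrite /S integral_nneseries//; last 2 first.
  - by move=> n; exact/measurable_EFinP.
  - by move=> n w _; rewrite lee_fin.
  apply: (@le_lt_trans _ _ 4%:E); last exact: ltry.
  apply: lime_le.
    by apply: is_cvg_nneseries => n _ _; apply: integral_ge0 => w _; rewrite lee_fin.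
  near=> n.
  apply: (@le_trans _ _ (\sum_(0 <= i < n) (2 * z ^+ i)%:E)%E).
    by apply: lee_sum => i _; exact: ID.
  rewrite sumEFin lee_fin.
  by rewrite geo; have := zn n; lra.
have mS : measurable_fun setT S.
  apply: ge0_emeasurable_sum => [n w _ _|n _]; first by rewrite lee_fin.
  exact/measurable_EFinP.
have S0 w : (0 <= S w)%E by apply: nneseries_ge0 => n _ _; rewrite lee_fin.
have iS : P.-integrable setT S.
  apply/integrableP; split => //.
  by rewrite (eq_integral S)// => w _; rewrite gee0_abs.
have cvgX w : S w \is a fin_num -> cvgn (X ^~ w).
  move=> Sfin.
  have : cvgn [normed series (telescope (X ^~ w))].
    apply: nondecreasing_is_cvgn.
      by apply: nondecreasing_series => n _ _; exact: normr_ge0.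
    exists (fine (S w)) => _ [n _ <-].
    rewrite -lee_fin fineK// /series/= -sumEFin.
    by apply: (@nneseries_lim_ge R (fun k => (D k w)%:E) xpredT 0 n) => k _ _; rewrite lee_fin.
  move/normed_cvg; rewrite telescopeK => h.
  rewrite (_ : X ^~ w = (fun n => X n w - X 0 w + X 0 w)).
    by apply: is_cvgD => //; exact: is_cvg_cst.
  by apply/funext => n; rewrite subrK.
(* The upper limit is measurable on the whole space, including the points where X n diverges. *)
pose Z w := fine (limn_esup (fun n => (X n w)%:E)).
exists Z.
  apply: measurableT_comp => //.
  by apply: measurable_fun_limn_esup => n; exact/measurable_EFinP.
have := integrable_ae measurableT iS; apply: filterS => w /(_ I) /cvgX cX.
have cE : (X n w)%:E @[n --> \oo] --> (limn (X ^~ w))%:E.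
  by apply: cvg_EFin => //; near=> n.
by rewrite /Z (cvg_limn_einf_sup cE).2/=.
Unshelve. all: by end_near. Qed.

End ae_limit.

(** * Laws of paths are determined by cosine transforms *)

Section threshold.
Context {R : realType}.

Lemma bernoulli_ge (x : R) m : 0 <= x <= 1 -> 1 - m%:R * x <= (1 - x) ^+ m.
Proof.
case/andP=> x0 x1; elim: m => [|m IH]; first by rewrite mul0r subr0 expr0.
rewrite exprS -natr1; have m0 : 0 <= m%:R :> R by rewrite ler0n.
by nra.
Qed.

Lemma bernoulli_le (x : R) m : 0 <= x <= 1 -> (1 - x) ^+ m * (1 + m%:R * x) <= 1.
Proof.
case/andP=> x0 x1; have m0 : 0 <= m%:R :> R by rewrite ler0n.
have B : 1 + m%:R * x <= (1 + x) ^+ m.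
  elim: m {m0} => [|m IH]; first by rewrite mul0r addr0 expr0.
  have m0 : 0 <= m%:R :> R by rewrite ler0n.
  by rewrite exprS -natr1; nra.
apply: (@le_trans _ _ ((1 - x) ^+ m * (1 + x) ^+ m)).
  by rewrite ler_wpM2l// exprn_ge0// subr_ge0.
rewrite -exprMn exprn_ile1//; nra.
Qed.

Lemma cvg_natM_geometric (q : R) : 0 <= q < 1 -> n%:R * q ^+ n @[n --> \oo] --> 0.
Proof.
case/andP=> q0 q1.
have [->|qn0] := eqVneq q 0.
  rewrite -[X in _ --> X](mul0r 0); apply: cvg_near_cst.
  near=> n; have n0 : (0 < n)%N by near: n; exact: nbhs_infty_gt.
  by rewrite mul0r expr0n gtn_eqF// mulr0.
have q_gt0 : 0 < q by rewrite lt_neqAle eq_sym qn0.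
(* Since q = s * s, one factor s^n keeps n s^n bounded by Bernoulli's inequality and the other tends
   to 0. *)
pose s := Num.sqrt q.
have s0 : 0 < s by rewrite sqrtr_gt0.
have s1 : s < 1 by rewrite -sqrtr1 ltr_sqrt.
have sq : q = s * s by rewrite -expr2 sqr_sqrtr.
pose D := s^-1 - 1.
have D0 : 0 < D by rewrite subr_gt0 invf_gt1.
have ns n : n%:R * s ^+ n <= D^-1.
  rewrite -[s]invrK exprVn ler_pdivrMr ?exprn_gt0 ?invr_gt0//.
  rewrite mulrC ler_pdivlMr// (_ : s^-1 = 1 + D); last by rewrite /D addrC subrK.
  elim: n => [|n IH]; first by rewrite mul0r expr0.
  have : 1 <= (1 + D) ^+ n by rewrite exprn_ege1// lerDl ltW.
  rewrite exprS -natr1 mulrDl mul1r; set y := (1 + D) ^+ n in IH *; nra.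
apply: (@squeeze_cvgr _ _ _ _ (fun=> 0) (fun n => D^-1 * s ^+ n)).
- near=> n; rewrite mulr_ge0 ?exprn_ge0//= sq exprMn mulrA ler_wpM2r//.
  by rewrite exprn_ge0// ltW.
- exact: cvg_cst.
- rewrite -[X in _ --> X](mulr0 D^-1); apply: cvgM; first exact: cvg_cst.
  by apply: cvg_expr; rewrite gtr0_norm.
Unshelve. all: by end_near. Qed.

(* A pointwise limit of polynomials in v which tests v < 1/2. *)
Lemma cvg_threshold (v : R) : 0 <= v <= 1 ->
  (1 - v ^+ n) ^+ (n * 2 ^ n) @[n --> \oo] --> ((v < 2^-1)%R%:R : R).
Proof.
case/andP=> v0 v1.
have vn n : 0 <= v ^+ n <= 1 by rewrite exprn_ge0// exprn_ile1.
(* The product of v^n and the exponent is n (2 v)^n: it tends to 0 for v < 1/2 and is at least n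
   otherwise. The factor n is what sends the boundary case v = 1/2 to 0. *)
have [v2|v2] := ltP v 2^-1.
  apply: (@squeeze_cvgr _ _ _ _ (fun n => 1 - n%:R * (2 * v) ^+ n) (fun=> 1)).
  - near=> n; apply/andP; split.
      have := bernoulli_ge (n * 2 ^ n) (vn n).
      by rewrite natrM natrX -mulrA -exprMn.
    have /andP[a b] := vn n.
    by rewrite exprn_ile1// ?subr_ge0// lerBlDr lerDl.
  - rewrite -[X in _ --> X](subr0 1); apply: cvgB; first exact: cvg_cst.
    by apply: cvg_natM_geometric; apply/andP; split; lra.
  - exact: cvg_cst.
apply: (@squeeze_cvgr _ _ _ _ (fun=> 0) (@harmonic R)).
- near=> n; have /andP[a b] := vn n.
  rewrite exprn_ge0 ?subr_ge0//=.
  rewrite /harmonic -[leRHS]mul1r ler_pdivlMr ?ltr0n//.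
  apply: le_trans (bernoulli_le (n * 2 ^ n) (vn n)).
  rewrite ler_wpM2l ?exprn_ge0 ?subr_ge0//.
  rewrite -natr1 addrC lerD2l natrM natrX -mulrA -exprMn.
  rewrite ler_peMr// exprn_ege1//; lra.
- exact: cvg_cst.
- exact: cvg_harmonic.
Unshelve. all: by end_near. Qed.

End threshold.

Section cramer_wold.
Context {R : realType} {d : measure_display} {Om : measurableType d}.
Variables (P Q : probability Om R) (Y : R -> Om -> R) (D : pred R).
Hypothesis mY : forall s, D s -> measurable_fun setT (Y s).

Notation good c := (all (fun x : R * R => D x.2) c).
Notation ev c w := (\sum_(x <- c) x.1 * Y x.2 w).

Hypothesis cosE : forall c theta, good c ->
  \int[P]_w cos (ev c w + theta) = \int[Q]_w cos (ev c w + theta).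

Let mev c : good c -> measurable_fun setT (fun w => ev c w).
Proof.
elim: c => [_|x c IH /= /andP[gx gc]].
  by under eq_fun do rewrite big_nil; exact: measurable_cst.
under eq_fun do rewrite big_cons.
apply: measurable_funD; last exact: IH.
by apply: measurable_funM => //; exact: mY.
Qed.

Let mcos : measurable_fun setT (@cos R).
Proof. by apply: continuous_measurable_fun; exact: continuous_cos. Qed.

Let mcosev c theta : good c -> measurable_fun setT (fun w => cos (ev c w + theta)).
Proof.
move=> gc; apply: (measurableT_comp mcos).
by apply: measurable_funD => //; exact: mev.
Qed.

(* The bounded functions whose products with the trigonometric functions of the
   process have the same expectation under P and Q.  Taking [v = (1 + cos _) / 2]
   in [cvg_threshold] shows that it contains the indicators of [cos_box]. *)
Definition cw_class (u : Om -> R) := [/\ measurable_fun setT u,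
  exists M, forall w, `|u w| <= M &
  forall c theta, good c ->
    \int[P]_w (u w * cos (ev c w + theta)) = \int[Q]_w (u w * cos (ev c w + theta))].

Let cw_int (mu : probability Om R) u c theta : cw_class u -> good c ->
  mu.-integrable setT (EFin \o (fun w => u w * cos (ev c w + theta))).
Proof.
case=> mu_ [M uM] _ gc.
have [] // := @bounded_has_integral _ _ _ mu (fun w => u w * cos (ev c w + theta)) M.
  by apply: measurable_funM => //; exact: mcosev.
move=> w; rewrite normrM -[leRHS]mulr1 ler_pM//.
exact: cos_max.
Qed.

Lemma cw_class1 : cw_class (fun=> 1).
Proof.
split=> //; first by exists 1 => _; rewrite normr1.
move=> c theta gc; under eq_Rintegral do rewrite mul1r.
by under [RHS]eq_Rintegral do rewrite mul1r; exact: cosE.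
Qed.

Lemma cw_class_lin a b u v : cw_class u -> cw_class v ->
  cw_class (fun w => a * u w + b * v w).
Proof.
move=> cu cv; have [mu_ [M uM] uE] := cu; have [mv [N vN] vE] := cv.
split.
- by apply: measurable_funD; apply: measurable_funM.
- exists (`|a| * M + `|b| * N) => w; rewrite (le_trans (ler_normD _ _))//.
  by rewrite !normrM lerD// ler_wpM2l.
move=> c theta gc.
have E (mu : probability Om R) : \int[mu]_w ((a * u w + b * v w) * cos (ev c w + theta)) =
    a * \int[mu]_w (u w * cos (ev c w + theta)) +
    b * \int[mu]_w (v w * cos (ev c w + theta)).
  have iu := cw_int mu theta cu gc; have iv := cw_int mu theta cv gc.
  rewrite -!RintegralZl// -RintegralD//.
  - by apply: eq_Rintegral => w _; ring.
  - exact: (integrableZl measurableT a iu).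
  - exact: (integrableZl measurableT b iv).
by rewrite !E uE// vE.
Qed.

(** The product formula for two cosines absorbs the new factor by adding [(a, s)] or [(- a, s)] to
    the combination; this is why the class quantifies over all combinations and phases. *)
Lemma cw_class_cos a s theta' u : D s -> cw_class u ->
  cw_class (fun w => u w * cos (a * Y s w + theta')).
Proof.
move=> Ds cu; have [mu_ [M uM] uE] := cu.
have mc : measurable_fun setT (fun w => cos (a * Y s w + theta')).
  apply: (measurableT_comp mcos); apply: measurable_funD => //.
  by apply: measurable_funM => //; exact: mY.
split; first exact: measurable_funM.
  by exists M => w; rewrite normrM -[leRHS]mulr1 ler_pM// cos_max.
move=> c theta gc.
have gp : good ((a, s) :: c) by rewrite /= Ds.
have gm : good ((- a, s) :: c) by rewrite /= Ds.
have E (mu : probability Om R) :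
    \int[mu]_w (u w * cos (a * Y s w + theta') * cos (ev c w + theta)) =
    2^-1 * (\int[mu]_w (u w * cos (ev ((a, s) :: c) w + (theta + theta'))) +
            \int[mu]_w (u w * cos (ev ((- a, s) :: c) w + (theta - theta')))).
  have ip := cw_int mu (theta + theta') cu gp.
  have im := cw_int mu (theta - theta') cu gm.
  rewrite -RintegralD// -RintegralZl//; last exact: (integrableD measurableT ip im).
  apply: eq_Rintegral => w _; rewrite !big_cons/=.
  set A := a * Y s w + theta'; set B := ev c w + theta.
  rewrite (_ : a * Y s w + _ + _ = B + A); last by rewrite /A /B; ring.
  rewrite (_ : - a * Y s w + _ + _ = B - A); last by rewrite /A /B; ring.
  by rewrite (cosD B A) (cosB B A); field.
by rewrite !E !uE.
Qed.

Lemma cw_class_lim (u_ : nat -> Om -> R) u M : (forall n, cw_class (u_ n)) ->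
  (forall n w, `|u_ n w| <= M) -> (forall w, u_ n w @[n --> \oo] --> u w) ->
  cw_class u.
Proof.
move=> cu uM uu.
have mu_ : measurable_fun setT u.
  by apply: (@measurable_fun_cvg _ _ _ _ u_) => // n; case: (cu n).
have uM' w : `|u w| <= M.
  have : `|u_ n w| @[n --> \oo] --> `|u w| by apply: cvg_norm; exact: uu.
  move=> h; rewrite -(cvg_lim _ h)//; apply: limr_le; first exact: cvgP h.
  by near=> n; exact: uM.
split => //; first by exists M.
move=> c theta gc.
have E (mu : probability Om R) :
    \int[mu]_w (u_ n w * cos (ev c w + theta)) @[n --> \oo] -->
   \int[mu]_w (u w * cos (ev c w + theta)).
  apply: (@bounded_cvg_Rintegral _ _ _ mu
    (fun n w => u_ n w * cos (ev c w + theta)) (fun w => u w * cos (ev c w + theta)) M).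
  - by move=> n; apply: measurable_funM; [case: (cu n)|exact: mcosev].
  - by apply: measurable_funM => //; exact: mcosev.
  - by move=> n w; rewrite normrM -[leRHS]mulr1 ler_pM// cos_max.
  - by apply: aeW => w; apply: cvgM; [exact: uu|exact: cvg_cst].
have EP := E P; have EQ := E Q.
rewrite (_ : (fun n => \int[P]_w _) = (fun n => \int[Q]_w (u_ n w * cos (ev c w + theta)))) in EP.
  exact: (cvg_unique _ EP EQ).
by apply/funext => n; case: (cu n) => _ _ ->.
Unshelve. all: by end_near. Qed.

(** Multipliers of the class: they compose, so powers and polynomials in a cosine are reached by
    iteration. *)
Definition cw_stable (f : Om -> R) := forall u, cw_class u -> cw_class (fun w => u w * f w).

Lemma cw_stable_cst a : cw_stable (fun=> a).
Proof.
move=> u cu; have := cw_class_lin a 0 cu cu.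
by congr cw_class; apply/funext => w; ring.
Qed.

Lemma cw_stableM f g : cw_stable f -> cw_stable g -> cw_stable (fun w => f w * g w).
Proof.
move=> cf cg u cu; have := cg _ (cf _ cu).
by congr cw_class; apply/funext => w; rewrite mulrA.
Qed.

Lemma cw_stableX f n : cw_stable f -> cw_stable (fun w => f w ^+ n).
Proof.
move=> cf; elim: n => [|n IH].
  by under eq_fun do rewrite expr0; exact: cw_stable_cst.
by under eq_fun do rewrite exprS; exact: cw_stableM.
Qed.

Lemma cw_stable_lin a b f g : cw_stable f -> cw_stable g ->
  cw_stable (fun w => a * f w + b * g w).
Proof.
move=> cf cg u cu; have := cw_class_lin a b (cf _ cu) (cg _ cu).
by congr cw_class; apply/funext => w; ring.
Qed.

Lemma cw_stable_cos_ge0 a s theta : D s ->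
  cw_stable (fun w => (0 <= cos (a * Y s w + theta))%R%:R).
Proof.
move=> Ds u cu.
pose v w := (1 + cos (a * Y s w + theta)) / 2.
have v01 w : 0 <= v w <= 1.
  have := cos_max (a * Y s w + theta); rewrite ler_norml => /andP[? ?].
  by apply/andP; rewrite /v; split; lra.
have sv : cw_stable v.
  rewrite (_ : v = fun w => 2^-1 * 1 + 2^-1 * cos (a * Y s w + theta)).
    apply: cw_stable_lin; first exact: cw_stable_cst.
    by move=> u' cu'; exact: cw_class_cos.
  by apply/funext => w; rewrite /v; field.
have [_ [M uM] _] := cu.
have pow01 w n m : 0 <= (1 - v w ^+ n) ^+ m <= 1.
  have /andP[v0 v1] := v01 w.
  rewrite exprn_ge0 ?exprn_ile1// ?subr_ge0 ?exprn_ile1//.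
  by rewrite lerBlDr lerDl exprn_ge0.
apply: (@cw_class_lim (fun n w => u w * (1 - (1 - v w ^+ n) ^+ (n * 2 ^ n))) _ M).
- move=> n; rewrite (_ : (fun w => _) = (fun w => u w *
     (1 * 1 + (-1) * (1 * 1 + (-1) * v w ^+ n) ^+ (n * 2 ^ n)))); last first.
    by apply/funext => w; rewrite !mul1r !mulN1r.
  apply: cw_stable_lin cu; first exact: cw_stable_cst.
  apply: cw_stableX; apply: cw_stable_lin; first exact: cw_stable_cst.
  exact: cw_stableX.
- move=> n w; rewrite normrM -[leRHS]mulr1 ler_pM//.
  have /andP[a0 a1] := pow01 w n (n * 2 ^ n)%N.
  by rewrite ger0_norm ?subr_ge0// lerBlDr lerDl.
- move=> w; apply: cvgM; first exact: cvg_cst.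
  have -> : (0 <= cos (a * Y s w + theta))%R%:R = 1 - (v w < 2^-1)%R%:R :> R.
    rewrite /v ltr_pdivrMr// mulVf// gtrDl ltNge; case: (0 <= _) => /=.
      by rewrite subr0.
    by rewrite subrr.
  by apply: cvgB; [exact: cvg_cst|exact: cvg_threshold].
Qed.

(** Entries are (frequency, time, phase). Concatenation of lists is intersection of boxes, which
    gives a pi-system. *)
Definition cos_box (l : seq (R * R * R)) : set Om :=
  [set w | all (fun x : R * R * R => 0 <= cos (x.1.1 * Y x.1.2 w + x.2)) l].

Lemma cw_class_box l : all (fun x : R * R * R => D x.1.2) l ->
  cw_class (\1_(cos_box l)).
Proof.
elim: l => [_|x l IH /= /andP[Dx Dl]].
  rewrite (_ : \1_ _ = fun=> 1); first exact: cw_class1.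
  by apply/funext => w; rewrite indicE mem_set.
have := cw_stable_cos_ge0 x.1.1 x.2 Dx (IH Dl).
congr cw_class; apply/funext => w; rewrite !indicE /cos_box.
have -> : (w \in [set w | all (fun x : R * R * R =>
    0 <= cos (x.1.1 * Y x.1.2 w + x.2)) (x :: l)]) =
   all (fun x : R * R * R => 0 <= cos (x.1.1 * Y x.1.2 w + x.2)) (x :: l).
  by apply/idP/idP => [/set_mem|?]; [|apply/mem_set].
have -> : (w \in [set w | all (fun x : R * R * R =>
    0 <= cos (x.1.1 * Y x.1.2 w + x.2)) l]) =
   all (fun x : R * R * R => 0 <= cos (x.1.1 * Y x.1.2 w + x.2)) l.
  by apply/idP/idP => [/set_mem|?]; [|apply/mem_set].
by rewrite /= -natrM mulnb andbC.
Qed.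

Lemma measurable_cos_box l : all (fun x : R * R * R => D x.1.2) l ->
  measurable (cos_box l).
Proof.
move=> gl; have [mI _ _] := cw_class_box gl.
have := mI measurableT [set 1] (measurable_set1 1); rewrite setTI.
congr measurable; apply/seteqP; split => w /=; rewrite indicE.
  by case: (boolP (w \in _)) => [/set_mem//|_ /eqP]; rewrite eq_sym oner_eq0.
by move=> bw; rewrite mem_set.
Qed.

Lemma cos_box_eq l : all (fun x : R * R * R => D x.1.2) l ->
  P (cos_box l) = Q (cos_box l).
Proof.
move=> gl; have mB := measurable_cos_box gl.
have [_ _ cE] := cw_class_box gl.
have E (mu : probability Om R) :
    \int[mu]_w (\1_(cos_box l) w * cos (ev [::] w + 0)) = fine (mu (cos_box l)).
  under eq_Rintegral do rewrite big_nil addr0 cos0 mulr1.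
  by rewrite /Rintegral integral_indic// setIT.
have := cE [::] 0 isT; rewrite !E => PQ.
by rewrite -[LHS]fineK ?fin_num_measure// PQ fineK// fin_num_measure.
Qed.

Lemma cos_boxI l1 l2 : cos_box l1 `&` cos_box l2 = cos_box (l1 ++ l2).
Proof.
by apply/seteqP; split => w; rewrite /cos_box/= all_cat => /andP.
Qed.

End cramer_wold.

Section dyadic_cos.
Context {R : realType}.

Lemma cos_lt0_pihalf_pi (x : R) : pi / 2 < x <= pi -> cos x < 0.
Proof.
case/andP=> x1 x2.
have p0 := pi_gt0 R.
have : 0 < cos (pi - x) by apply: cos_gt0_pihalf; apply/andP; split; lra.
by rewrite cosB cospi sinpi mul0r addr0 mulN1r oppr_gt0.
Qed.

(* Recovers intervals from the sets where a cosine is nonnegative. *)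
Lemma dyadic_cos_ge0 (x : R) :
  `|x| <= pi / 2 <-> forall j : nat, 0 <= cos (x / 2 ^+ j).
Proof.
have p0 := pi_gt0 R.
have e0 j : 0 < (2 : R) ^+ j by rewrite exprn_gt0.
split=> [xp j|H].
  apply: cos_ge0_pihalf; rewrite -ler_norml normrM.
  rewrite (@ger0_norm _ (2 ^+ j)^-1) ?invr_ge0 ?(ltW (e0 j))//.
  by rewrite (le_trans _ xp)// ler_piMr// invf_le1// exprn_ege1// ler1n.
rewrite leNgt; apply/negP => xp.
have ex : exists j, `|x| / 2 ^+ j <= pi.
  exists (Num.truncn `|x|).+1; rewrite ler_pdivrMr//.
  apply: (@le_trans _ _ (1 * 2 ^+ (Num.truncn `|x|).+1)).
    rewrite mul1r (le_trans (ltW (truncnS_gt _)))// -natrX ler_nat.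
    exact/ltnW/ltn_expl.
  rewrite ler_pM2r//; have := pi_ge2 R; lra.
(* For the least j with |x| / 2^j <= pi, the quotient also exceeds pi/2: by minimality if j > 0, by
   assumption if j = 0. The cosine is negative there. *)
have [j jp jm] := ex_minnP ex.
have jh : pi / 2 < `|x| / 2 ^+ j.
  case: j jp jm => [|j] jp jm; first by rewrite expr0 divr1.
  rewrite ltNge; apply/negP => h; have := jm j.
  rewrite ltnn => /(_ _)/notF; apply.
  move: h; rewrite exprS invfM mulrCA mulrC ler_pM2r//.
have : cos (x / 2 ^+ j) < 0.
  rewrite -cos_norm normrM (@ger0_norm _ (2 ^+ j)^-1) ?invr_ge0 ?(ltW (e0 j))//.
  by apply: cos_lt0_pihalf_pi; rewrite jh jp.
by rewrite ltNge H.
Qed.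

End dyadic_cos.

Section path_law.
Context {R : realType}.
Variable T : R.

Notation Om := (path_space T).
Notation Y := (@canonical_process R T).
Notation D := (fun s : R => 0 <= s <= T).
Notation good c := (all (fun x : R * R => 0 <= x.2 <= T) c).

Lemma measurable_canonical_process s : D s -> measurable_fun setT (Y s : Om -> R).
Proof.
move=> Ds _ A mA; rewrite setTI.
apply: sub_sigma_algebra; exists s; first by rewrite in_itv.
by exists A.
Qed.

Variables P Q : probability Om R.
Hypothesis cosE : forall c theta, good c ->
  \int[P]_w cos (\sum_(x <- c) x.1 * Y x.2 w + theta) =
  \int[Q]_w cos (\sum_(x <- c) x.1 * Y x.2 w + theta).

Definition box_system : set (set Om) :=
  [set B | exists2 l : seq (R * R * R), all (fun x => 0 <= x.1.2 <= T) l &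
     B = cos_box Y l].

Let measurable_canonical_box s : D s ->
  measurable_fun setT (Y s : g_sigma_algebraType box_system -> R).
Proof.
move=> Ds; apply: (measurability (@RGenCInfty.G R)) => [|/= _ [_] [r] -> <-].
  exact: RGenCInfty.measurableE.
rewrite setTI.
(* The half-line [r, +oo[ is the increasing union of the intervals [r, r + 2(n + 1)]; scaling by [a]
   turns each into the condition of [dyadic_cos_ge0]. *)
pose ball (n : nat) : set Om := [set w | `|Y s w - (r + n.+1%:R)| <= n.+1%:R].
have -> : Y s @^-1` `[r, +oo[ = \bigcup_n ball n.
  apply/seteqP; split => w /=; rewrite in_itv/= andbT.
    move=> rY; exists (Num.truncn (Y s w - r)) => //=.
    have h := truncnS_gt (Y s w - r); rewrite /ball/= ler_norml.
    by apply/andP; split; lra.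
  by case=> n _; rewrite /ball/= ler_norml => /andP[h _]; lra.
apply: bigcup_measurable => n _.
pose a : R := pi / 2 / n.+1%:R.
have n0 : 0 < n.+1%:R :> R by rewrite ltr0n.
have -> : ball n = \bigcap_j cos_box Y [:: ((a / 2 ^+ j, s), - (r + n.+1%:R) * (a / 2 ^+ j))].
  have E w : (`|Y s w - (r + n.+1%:R)| <= n.+1%:R) = (`|a * (Y s w - (r + n.+1%:R))| <= pi / 2).
    have a0 : 0 < a by rewrite !divr_gt0// pi_gt0.
    rewrite normrM gtr0_norm// mulrC -ler_pdivlMr// /a invf_div mulrCA divff ?mulr1//.
    by rewrite gt_eqF// divr_gt0// pi_gt0.
  apply/seteqP; split => w; rewrite /ball/= E.
    move=> /dyadic_cos_ge0 h j _; rewrite /cos_box/= andbT; have := h j.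
    by congr (0 <= cos _); ring.
  move=> h; apply/dyadic_cos_ge0 => j; have := h j I.
  by rewrite /cos_box/= andbT; congr (0 <= cos _); ring.
apply: bigcap_measurable => // j _.
by apply: sub_sigma_algebra; eexists; last reflexivity; rewrite /= Ds.
Qed.

Lemma measurable_box_system : @measurable _ Om = <<s box_system >>.
Proof.
apply/seteqP; split; last first.
  apply: smallest_sub; first exact: sigma_algebra_measurable.
  move=> _ [l gl ->]; apply: (@measurable_cos_box _ _ _ P Q Y D) => //.
  exact: measurable_canonical_process.
apply: smallest_sub; first exact: smallest_sigma_algebra.
move=> A [s Ds [E mE AE]]; rewrite in_itv /= in Ds.
by have := measurable_canonical_box Ds measurableT mE; rewrite setTI AE.
Qed.

Lemma path_law_eq A : measurable A -> P A = Q A.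
Proof.
move=> mA; apply: (measure_unique box_system (fun=> setT)) => //.
- exact: measurable_box_system.
- move=> _ _ [l gl ->] [l' gl' ->]; exists (l ++ l'); first by rewrite all_cat gl.
  exact: cos_boxI.
- by move=> _; exists [::] => //; apply/seteqP; split.
- by apply/seteqP; split => // w _; exists 0%N.
- move=> _ [l gl ->]; apply: (@cos_box_eq _ _ _ P Q Y D) => //.
  exact: measurable_canonical_process.
- by move=> _; exact: (le_lt_trans (probability_le1 P measurableT) (ltry 1)).
Qed.

End path_law.

(** * Invariance of the law under resampling of one Gaussian coordinate *)

Section shift.
Context {R : realType} (T : R).
Variable f : R -> R.
Hypothesis cf : {within `[0, T], continuous f}.
Hypothesis f0 : f 0 = 0.
Hypothesis T_ge0 : 0 <= T.

(** The value 0 off [0, T] keeps the shifted path in the chosen representation of C_0([0, T]). *)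
Definition shift_fun (w : C0 T) (a s : R) : R :=
  if s \in `[0, T] then (val : C0 T -> R -> R) w s + a * f s else 0.

Lemma shift_fun_C0 (w : C0 T) a : shift_fun w a \in C0_set T.
Proof.
have /set_mem[cw w0 _] := valP w; apply/mem_set; split.
- have : {within `[0, T], continuous (fun s => (val : C0 T -> R -> R) w s + a * f s)}.
    apply: (@within_continuousD _ _ _ _ ((val : C0 T -> R -> R) w) (fun s => a * f s)).
      exact: cw.
    by move=> x; apply: cvgM; [exact: cvg_cst|exact: cf].
  apply: subspace_eq_continuous => s; rewrite inE/= => sT.
  by rewrite /from_subspace/= /shift_fun sT.
- by rewrite /shift_fun in_itv/= lexx T_ge0/= w0 f0 mulr0 addr0.
- by move=> s sT; rewrite /shift_fun (negbTE sT).
Qed.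

Definition shift_path (w : path_space T) (a : R) : path_space T :=
  exist (fun x => x \in C0_set T) (shift_fun w a) (shift_fun_C0 w a).

Lemma shift_pathE w a s : 0 <= s <= T ->
  canonical_process s (shift_path w a) = canonical_process s w + a * f s.
Proof. by move=> sT; rewrite /canonical_process/= /shift_fun in_itv/= sT. Qed.

Lemma measurable_shift d (E : measurableType d) (W : E -> path_space T) (A : E -> R) :
  measurable_fun setT W -> measurable_fun setT A ->
  measurable_fun setT (fun e => shift_path (W e) (A e)).
Proof.
move=> mW mA.
apply: (@measurability _ _ _ (path_space T) setT _ (@cylinder R T)) => // _ [_ [s sT [B mB ->]] <-].
have sT' : 0 <= s <= T by move: sT; rewrite in_itv.
rewrite setTI; pose y e := canonical_process s (W e) + A e * f s.
have my : measurable_fun setT y.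
  apply: measurable_funD; last exact: measurable_funM.
  exact: (measurableT_comp (measurable_canonical_process sT') mW).
have := my measurableT _ mB; rewrite setTI; congr measurable.
by apply/seteqP; split => e; rewrite /y /= -shift_pathE.
Qed.

End shift.

Section quasi_invariance.
Context {R : realType} (T : R).
Hypothesis T_ge0 : 0 <= T.
Notation Om := (path_space T).
Notation W := (@canonical_process R T).
Notation g := (@gauss R).
Notation kappa := (@gauss_sqr R).
Notation good c := (all (fun x : R * R => 0 <= x.2 <= T) c).

Variables (P : probability Om R) (H : R).
Hypothesis B_fbm : is_fbm P H T W.

Variables (h : R -> R) (C0 t : R).
Hypothesis C0_gt0 : 0 < C0.
Hypothesis h_rkhs : forall c, good c -> comb_eval h c ^+ 2 <= C0 * fbm_ip H c c.
Hypotheses (t_itv : 0 <= t <= T) (ht : h t != 0).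

Let fbm_covC s u : fbm_cov H s u = fbm_cov H u s.
Proof. by rewrite /fbm_cov distrC (addrC (s `^ _)). Qed.

(* N is the limit of the approximants of [riesz_sequence], normalized; subtracting
   from a combination of coordinates its projection on N leaves a Gaussian
   variable of variance [V], to which the variance coming from z.2 is added back. *)
Lemma fbm_shift_cos : exists (N : Om -> R) (k : R), [/\ measurable_fun setT N, 0 < k &
  forall c theta, good c ->
   has_integral (P \x g)%E setT
     (fun z : Om * measurableTypeR R =>
        cos (comb W c z.1 + (z.2 - N z.1) * (k * comb_eval h c) + theta))
     (cos theta * gauss_char (fbm_ip H c c))].
Proof.
have k0 := @gauss_sqr_gt0 R.
have [N [v [gN v0 Nv Nh Nd]]] :=
  @riesz_sequence R (fbm_cov H) h (fun s => 0 <= s <= T) C0 fbm_covC C0_gt0 h_rkhs t t_itv ht.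
have mcomb c : good c -> measurable_fun setT (comb W c : Om -> R).
  by move=> gc; case: (comb_gaussian B_fbm gc).
have combD c d w : comb W (c ++ d) w = comb W c w + comb W d w.
  by rewrite /comb big_cat.
have combZ a c w : comb W (comb_scale a c) w = a * comb W c w.
  by rewrite /comb big_map mulr_sumr; apply: eq_bigr => x _; rewrite mulrA.
have goodZ a c : good c -> good (comb_scale a c).
  by rewrite all_map => /allP gc; apply/allP => x /gc.
have goodD c d : good c -> good d -> good (c ++ d) by rewrite all_cat => -> ->.
have [Z mZ NZ] : exists2 Z : Om -> R, measurable_fun setT Z &
    {ae P, forall w, comb W (N n) w @[n --> \oo] --> Z w}.
  apply: ae_cvg_fast_L2 => [n|n]; first exact: mcomb.
  eexists; first exact: Nd n.
  have := comb_sqr B_fbm (goodD _ _ (gN n.+1) (goodZ (-1) _ (gN n))).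
  congr has_integral; apply/funext => w.
  by rewrite combD combZ mulN1r.
pose sg := Num.sqrt (v / kappa).
have sg0 : 0 < sg by rewrite sqrtr_gt0 divr_gt0.
have sg2 : sg ^+ 2 = v / kappa by rewrite sqr_sqrtr// divr_ge0 ?ltW.
(* Z has variance v, so dividing by [sg] gives it the variance [kappa] of the independent variable
   z.2, and the factor [sg / v] makes the subtracted term equal to the projection (l / v) Z. *)
exists (fun w => Z w / sg), (sg / v); split.
- exact: measurable_funM.
- exact: divr_gt0.
move=> c theta gc; set l := comb_eval h c.
pose V := fbm_ip H c c - l ^+ 2 / v.
pose U w := comb W c w - l / v * Z w.
(* Finite combinations converging almost surely to the residual [U]; the cosine transform of [U] is
   obtained as their limit. *)
pose a n := c ++ comb_scale (- (l / v)) (N n).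
have ga n : good (a n) by apply: goodD => //; exact: goodZ.
have aV : fbm_ip H (a n) (a n) @[n --> \oo] --> V.
  have -> : V = fbm_ip H c c - 2 * (l / v) * l + (l / v) ^+ 2 * v.
    by rewrite /V; field; rewrite gt_eqF.
  rewrite (_ : (fun n => _) = (fun n => fbm_ip H c c -
      2 * (l / v) * fbm_ip H (N n) c + (l / v) ^+ 2 * fbm_ip H (N n) (N n))).
    apply: cvgD; last by apply: cvgM; [exact: cvg_cst|exact: Nv].
    apply: cvgB; first exact: cvg_cst.
    by apply: cvgM; [exact: cvg_cst|exact: Nh].
  apply/funext => n; rewrite -[fbm_ip]/(fun H => kernel_ip (fbm_cov H))/=.
  by rewrite !ipE (kernel_ipC fbm_covC c (N n)); ring.
have V0 : 0 <= V.
  rewrite -(cvg_lim _ aV)//; apply: limr_ge; first exact: cvgP aV.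
  by apply: nearW => n; exact: (fbm_ip_ge0 B_fbm (ga n)).
have mU : measurable_fun setT U.
  by apply: measurable_funB; [exact: mcomb|exact: measurable_funM].
have mcosP (X : Om -> R) th : measurable_fun setT X ->
    measurable_fun setT (fun w => cos (X w + th)).
  move=> mX; apply: (measurableT_comp (continuous_measurable_fun (@continuous_cos R))).
  exact: measurable_funD.
have UI th : has_integral P setT (fun w => cos (U w + th)) (cos th * gauss_char V).
  have [iU _] : has_integral P setT (fun w => cos (U w + th)) (\int[P]_w cos (U w + th)).
    by apply: (@bounded_has_integral _ _ _ _ _ 1) => [|w];
      [exact: mcosP|exact: cos_max].
  split => //.
  have L1 : \int[P]_w cos (comb W (a n) w + th) @[n --> \oo] -->
      \int[P]_w cos (U w + th).
    apply: (@bounded_cvg_Rintegral _ _ _ P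
      (fun n w => cos (comb W (a n) w + th)) (fun w => cos (U w + th)) 1).
    - by move=> n; apply: mcosP; exact: mcomb.
    - exact: mcosP.
    - by move=> n w; exact: cos_max.
    - apply: filterS NZ => w Nw.
      apply: (@cvg_comp _ _ _ (fun n => comb W (a n) w + th) cos); last exact: continuous_cos.
      apply: cvgD; last exact: cvg_cst.
      under eq_fun do rewrite combD combZ mulNr.
      apply: cvgB; first exact: cvg_cst.
      by apply: cvgM; [exact: cvg_cst|exact: Nw].
  have L2 : \int[P]_w cos (comb W (a n) w + th) @[n --> \oo] --> cos th * gauss_char V.
    rewrite (_ : (fun n => _) = (fun n => cos th * gauss_char (fbm_ip H (a n) (a n)))).
      by apply: cvgM; [exact: cvg_cst|exact: cvg_gauss_char].
    by apply/funext => n; case: (comb_cos B_fbm th (ga n)).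
  exact: cvg_unique L1 L2.
(* The independent term tau * z.2 has variance tau^2 kappa = l^2 / v, exactly what [V] lacks. *)
pose tau := sg / v * l.
pose G (z : Om * measurableTypeR R) := cos (U z.1 + (tau * z.2 + theta)).
have mG : measurable_fun setT G.
  apply: (measurableT_comp (continuous_measurable_fun (@continuous_cos R))).
  apply: measurable_funD; first exact: (measurableT_comp mU).
  by apply: measurable_funD => //; apply: measurable_funM.
rewrite (_ : (fun z : Om * measurableTypeR R => _) = G); last first.
  apply/funext => z; rewrite /G /U /tau -/l; congr cos.
  by field; rewrite !gt_eqF.
have [iG _] : has_integral (P \x g)%E setT G (\int[(P \x g)%E]_z G z).
  by apply: (@bounded_has_integral _ _ _ (P \x g)%E _ 1) => // z; exact: cos_max.
split => //.
rewrite /Rintegral -(integral21_prod_meas1 iG).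
transitivity (fine (\int[g]_y (gauss_char V * cos (tau * y + theta))%:E)%E).
  congr fine; apply: eq_integral => y _.
  have [iy ey] := UI (tau * y + theta).
  by rewrite mulrC -ey /Rintegral fineK//; exact: integrable_fin_num iy.
have [_ e] := has_integralZ (gauss_char V) measurableT (gauss_cos_has_integral tau theta).
rewrite -/(Rintegral _ _ _) e mulrCA; congr (_ * _).
have -> : gauss_cos tau = gauss_char (l ^+ 2 / v).
  rewrite /gauss_char (_ : l ^+ 2 / v / kappa = tau ^+ 2).
    rewrite sqrtr_sqr; have [?|?] := leP 0 tau; first by rewrite ger0_norm.
    by rewrite ltr0_norm// gauss_cosN.
  by rewrite /tau exprMn exprMn sg2; field; rewrite !gt_eqF.
rewrite gauss_charD//; last by rewrite divr_ge0 ?sqr_ge0// ltW.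
by congr gauss_char; rewrite /V subrK.
Unshelve. all: by end_near. Qed.

Hypothesis h_cont : {within `[0, T], continuous h}.
Hypothesis h0 : h 0 = 0.

(** By [fbm_shift_cos], the image of P x g under Phi has the cosine transforms that [comb_cos] gives
    for P, so [path_law_eq] identifies the two laws. *)
Lemma fbm_shift_law : exists (N : Om -> R) (k : R)
    (Phi : Om * measurableTypeR R -> Om), [/\ 0 < k, measurable_fun setT Phi,
  forall z s, 0 <= s <= T -> W s (Phi z) = W s z.1 + (z.2 - N z.1) * (k * h s) &
  forall A, measurable A -> (P \x g)%E (Phi @^-1` A) = P A].
Proof.
have [N [k [mN k0 NE]]] := fbm_shift_cos.
have cf : {within `[0, T], continuous (fun s => k * h s)}.
  by move=> x; apply: cvgM; [exact: cvg_cst|exact: h_cont].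
have f0 : k * h 0 = 0 by rewrite h0 mulr0.
pose Phi (z : Om * measurableTypeR R) : Om := shift_path cf f0 T_ge0 z.1 (z.2 - N z.1).
have mPhi : measurable_fun setT Phi.
  apply: measurable_shift; first exact: measurable_fst.
  apply: measurable_funB; first exact: measurable_snd.
  exact: (measurableT_comp mN).
exists N, k, Phi; split => //.
  by move=> z s sT; rewrite shift_pathE.
pose mX := isMeasurableFun.Build _ _ _ Om Phi mPhi.
pose X : {RV (P \x g)%E >-> Om} := HB.pack Phi mX.
move=> A mA; pose Q : probability Om R := distribution (P \x g)%E X.
apply: (@path_law_eq R T Q P _ A mA).
move=> c theta gc.
have [_ ->] := comb_cos B_fbm theta gc.
have [iN eN] := NE c theta gc.
rewrite -eN /Rintegral; congr fine.
rewrite integral_distribution//.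
- apply: eq_integral => z _ /=; congr (cos (_ + _))%:E.
  rewrite /comb /comb_eval !mulr_sumr -big_split big_seq [RHS]big_seq.
  apply: eq_bigr => x xc; rewrite shift_pathE; last exact: (allP gc).
  by rewrite /=; ring.
- apply/measurable_EFinP.
  apply: (measurableT_comp (continuous_measurable_fun (@continuous_cos R))).
  apply: measurable_funD => //.
  by case: (comb_gaussian B_fbm gc).
move: iN; congr (_.-integrable _ _); apply/funext => z /=; congr (cos (_ + _))%:E.
rewrite /comb /comb_eval !mulr_sumr -big_split big_seq [RHS]big_seq.
apply: eq_bigr => x xc; rewrite shift_pathE; last exact: (allP gc).
by rewrite /=; ring.
Qed.

End quasi_invariance.

(** * Lower bound on the density *)

Section hitting.
Context {R : realType}.

(* [z0] is the supremum of the points of S where F <= x. *)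
Lemma dense_lipschitz_hit (S : set R) (F : R -> R) (c1 c2 c3 K x z1 : R) :
  0 < c1 -> 0 < c2 -> 0 <= c3 ->
  (forall u v, u < v -> exists2 z, S z & u < z < v) ->
  (forall z z', S z -> S z' -> z <= z' ->
     `|F z' - F z| <= c2 * (z' - z) /\ c1 * (z' - z) - c3 <= F z' - F z) ->
  S z1 -> `|z1| <= K -> `|F z1| <= K ->
  exists z0, `|z0| <= K + (`|x| + K + c3) / c1 + 2 /\
    forall eps z, 0 < eps -> S z -> `|z - z0| < eps / (2 * c2) -> `|F z - x| < eps.
Proof.
move=> c10 c20 c30 dS HF Sz1 z1K Fz1K.
set L := (`|x| + K + c3) / c1.
have c1L : c1 * L = `|x| + K + c3 by rewrite /L mulrC divfK// gt_eqF.
have L0 : 0 <= L by rewrite divr_ge0 ?(ltW c10)// !addr_ge0// (le_trans _ z1K).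
move: Fz1K; rewrite ler_norml => /andP[Fz1a Fz1b].
move: (z1K); rewrite ler_norml => /andP[z1a z1b].
have xa := ler_norm x; have xc : - `|x| <= x by rewrite lerNl ler_normr lexx orbT.
pose U := [set z | S z /\ F z <= x].
(* L is chosen so that moving left by more than L brings F below x and moving right by more than L
   brings it above x, despite the loss c3. *)
have [zl Szl /andP[zl1 zl2]] := dS (z1 - L - 2) (z1 - L - 1) ltac:(lra).
have Uzl : U zl.
  split=> //; have [_ h] := HF zl z1 Szl Sz1 ltac:(lra).
  by nra.
have Uub z : U z -> z <= z1 + L.
  case=> Sz Fz; rewrite leNgt; apply/negP => zz.
  have [_ h] := HF z1 z Sz1 Sz ltac:(lra).
  by nra.
have supU : has_sup U by split; [exists zl|exists (z1 + L)].
pose z0 := sup U.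
have z0l : zl <= z0 by apply: ub_le_sup => //; case: supU.
have z0u : z0 <= z1 + L by apply: ge_sup => //; exists zl.
exists z0; split; first by rewrite ler_norml; apply/andP; split; lra.
move=> eps z e0 Sz zz0.
(* The error splits into c2 |z - z0| < eps/2, c2 eta = eps/6 and 2 c2 eta = eps/3. As z0 may lie
   outside S, it is bracketed by u <= z0 < v in S with F u <= x < F v and v - u < 2 eta. *)
pose eta := eps / (6 * c2).
have eta0 : 0 < eta by rewrite divr_gt0// mulr_gt0.
have [u [Su Fu] zu] := sup_adherent eta0 supU.
have [v Sv /andP[zv1 zv2]] := dS z0 (z0 + eta) ltac:(lra).
have u0 : u <= z0 by apply: ub_le_sup => //; case: supU.
have Fv : x < F v.
  rewrite ltNge; apply/negP => Fv.
  suff : v <= z0 by rewrite leNgt zv1.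
  by apply: ub_le_sup => //; case: supU.
have [huv _] := HF u v Su Sv ltac:(lra).
have lip : `|F z - F v| <= c2 * `|z - v|.
  have [zv|/ltW vz] := leP z v.
    by have [h _] := HF z v Sz Sv zv; rewrite distrC (distrC z) [`|v - z|]ger0_norm// subr_ge0.
  by have [h _] := HF v z Sv Sz vz; rewrite [`|z - v|]ger0_norm// subr_ge0.
have zv : `|z - v| <= `|z - z0| + eta.
  rewrite (_ : z - v = (z - z0) + (z0 - v)); last by ring.
  by rewrite (le_trans (ler_normD _ _))// lerD2l ltr0_norm; lra.
have e1 : c2 * eta = eps / 6 by rewrite /eta; field; rewrite gt_eqF.
have e2 : c2 * `|z - z0| < eps / 2.
  by rewrite mulrC -ltr_pdivlMr// (lt_le_trans zz0)// -mulrA -invfM lexx.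
have Fvu : `|F v - x| <= 2 * (c2 * eta).
  rewrite ger0_norm; last lra.
  have vu : c2 * (v - u) <= c2 * (2 * eta).
    by rewrite ler_pM2l//; rewrite -/z0 in zu; lra.
  by move: huv; rewrite ler_norml => /andP[_ h]; lra.
rewrite (_ : F z - x = (F z - F v) + (F v - x)); last by ring.
rewrite (le_lt_trans (ler_normD _ _))//.
by nra.
Qed.

Lemma smooth_bounded_lipschitz (b : R -> R) : smooth_bounded_on setT b ->
  exists B beta : R, [/\ 0 <= B, 0 < beta, continuous b, forall y, `|b y| <= B &
    forall x y, `|b x - b y| <= beta * `|x - y|].
Proof.
move=> [sb bb].
have db x : derivable b x 1 by exact: (sb 0%N x).
have [B HB] := bb 0%N; have [M HM] := bb 1%N.
have HB' y : `|b y| <= B by exact: HB.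
have HM' y : `|derive1 b y| <= M by exact: HM.
have cb : continuous b by move=> x; apply/differentiable_continuous/derivable1_diffP.
have M0 : 0 <= M by exact: le_trans (HM' 0).
(* M may be 0, whereas Gronwall divides by the Lipschitz constant. *)
exists B, (M + 1); split => //.
- exact: le_trans (HB' 0).
- by rewrite ltr_wpDl.
move=> x y; wlog yx : x y / y <= x.
  move=> W; have [|/ltW xy] := leP y x; first exact: W.
  by rewrite distrC (distrC x); exact: W.
have [c _ ->] : exists2 c, c \in `[y, x] & b x - b y = derive1 b c * (x - y).
  apply: MVT_segment => //.
    by move=> z _; rewrite derive1E; apply: DeriveDef.
  exact: continuous_subspaceT.
rewrite normrM ler_wpM2r// (le_trans (HM' c))// lerDl//.
Qed.

Notation phi := (normal_pdf (0 : R) 1).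

Lemma gauss_itv_ge (M u v : R) : u <= v -> - M <= u -> v <= M ->
  (((v - u) * phi M)%:E <= @gauss R `]u, v[%classic)%E.
Proof.
move=> uv Mu vM.
apply: (@le_trans _ _ (\int[lebesgue_measure]_(x in `]u, v[) (phi M)%:E)%E).
  rewrite integral_cst//= lebesgue_measure_itv/= lte_fin.
  move: uv; rewrite le_eqVlt => /predU1P[->|uv].
    by rewrite ltxx subrr mul0r mule0.
  by rewrite uv -EFinB -EFinM mulrC.
apply: ge0_le_integral => //.
- by move=> x _; rewrite lee_fin normal_pdf_ge0.
- by apply/measurable_EFinP; apply: measurable_funTS; exact: measurable_normal_pdf.
move=> x /=; rewrite in_itv/= => /andP[ux xv]; rewrite lee_fin.
rewrite !normal_pdfE// ler_pM2l ?normal_peak_gt0// ler_expR !subr0.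
rewrite ler_pM2r ?invr_gt0// lerN2 -(real_normK (num_real x)).
have M0 : 0 <= M by lra.
by rewrite ler_sqr ?nnegrE// ler_norml; apply/andP; split; lra.
Qed.

(** If p x were 0, continuity would give p < c/4 near x, and a small interval of length 2e would
    carry mass at most c e / 2. *)
Lemma density_gt0 d (Om : measurableType d) (P : probability Om R) (Y : {RV P >-> R})
    (p : R -> R) (x c e0 : R) : is_smooth_density Y p -> 0 < c -> 0 < e0 ->
  (forall e, 0 < e < e0 -> ((c * e)%:E <= P (Y @^-1` `](x - e)%R, (x + e)%R[%classic))%E) ->
  0 < p x.
Proof.
move=> [sp p0 pE] c0 e00 H.
have cp : continuous p.
  by move=> y; apply/differentiable_continuous/derivable1_diffP; exact: (sp 0%N y).
rewrite lt_neqAle p0 andbT; apply/eqP => px.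
have c40 : 0 < c / 4 by rewrite divr_gt0.
have := cp x; move/cvgrPdist_lt => /(_ _ c40); rewrite -px => -[dl /= dl0 Hd].
pose e := Num.min dl e0 / 2.
have e_gt0 : 0 < e by rewrite divr_gt0// lt_min dl0.
have ed : e < dl.
  by rewrite /e ltr_pdivrMr// (le_lt_trans (y := dl)) ?ge_min ?lexx// ltr_pMr// ltr1n.
have ee0 : e < e0.
  by rewrite /e ltr_pdivrMr// (le_lt_trans (y := e0)) ?ge_min ?lexx ?orbT// ltr_pMr// ltr1n.
have := H e; rewrite e_gt0 ee0 => /(_ isT).
rewrite -[X in (_ <= X)%E]/(distribution P Y `](x - e)%R, (x + e)%R[%classic) pE//.
apply/negP; rewrite -ltNge.
apply: (@le_lt_trans _ _ (\int[lebesgue_measure]_(y in `](x - e)%R, (x + e)%R[) (c / 4)%:E)%E).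
  apply: ge0_le_integral => //.
  - by move=> y _; rewrite lee_fin.
  - by apply/measurable_EFinP; apply: measurable_funTS; exact: continuous_measurable_fun.
  move=> y /=; rewrite in_itv/= => /andP[y1 y2]; rewrite lee_fin ltW//.
  have xy : `|x - y| < dl by rewrite ltr_norml; apply/andP; split; lra.
  by have := Hd y xy; rewrite /= sub0r normrN ger0_norm.
rewrite integral_cst//= lebesgue_measure_itv/= lte_fin ifT; last lra.
by rewrite -EFinB -EFinM lte_fin; nra.
Qed.

End hitting.

Section gauss_hit.
Context {R : realType}.
Notation g := (@gauss R).
Notation phi := (normal_pdf (0 : R) 1).
Variables (c1 c2 c3 K x : R).
Hypotheses (c1_gt0 : 0 < c1) (c2_gt0 : 0 < c2) (c3_ge0 : 0 <= c3).

(** The bound on z0 from [dense_lipschitz_hit], plus 1 for the radius e/(2 c2) around it. In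
    [hit_const] this interval has length e/c2 and Gaussian density at least [phi hit_bound]. *)
Definition hit_bound : R := K + (`|x| + K + c3) / c1 + 2 + 1.
Definition hit_const : R := phi hit_bound / c2.

Lemma hit_const_gt0 : 0 < hit_const.
Proof.
by rewrite divr_gt0// normal_pdfE// mulr_gt0 ?normal_peak_gt0 ?expR_gt0.
Qed.

Lemma gauss_hit (S : set (measurableTypeR R)) (F : R -> R) :
  measurable S -> g (~` S) = 0%E -> measurable_fun setT (F : measurableTypeR R -> R) ->
  (forall z z', S z -> S z' -> z <= z' ->
     `|F z' - F z| <= c2 * (z' - z) /\ c1 * (z' - z) - c3 <= F z' - F z) ->
  (exists z1, [/\ S z1, `|z1| <= K & `|F z1| <= K]) ->
  forall e, 0 < e < c2 -> ((hit_const * e)%:E <= g (F @^-1` `](x - e)%R, (x + e)%R[%classic))%E.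
Proof.
move=> mS nS mF HF [z1 [Sz1 z1K Fz1K]] e /andP[e0 ec].
have gle (A : set (measurableTypeR R)) : measurable A -> (g A <= g (A `&` S))%E.
  move=> mA; rewrite -{1}(setIT A) -(setUv S) setIUr measureU//.
  - rewrite [X in (_ + X)%E](_ : _ = 0%E) ?adde0//.
    apply/eqP; rewrite eq_le measure_ge0 andbT -nS le_measure ?inE//.
    + by apply: measurableI => //; exact: measurableC.
    + exact: measurableC.
  - exact: measurableI.
  - by apply: measurableI => //; exact: measurableC.
  - by rewrite setIACA setICr setI0.
(* Every open interval has positive Gaussian measure, so a set of full measure meets it. *)
have dS u v : u < v -> exists2 z, S z & u < z < v.
  move=> uv; apply: contrapT => H.
  have uv0 : g (`]u, v[%classic `&` S) = 0%E.
    rewrite (_ : _ `&` _ = set0) ?measure0//.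
    apply/seteqP; split => // z [/=]; rewrite in_itv/= => uzv Sz.
    by apply: H; exists z.
  pose M := Num.max `|u| `|v|.
  have uM : `|u| <= M by rewrite le_max lexx.
  have vM : `|v| <= M by rewrite le_max lexx orbT.
  have := @gauss_itv_ge R M u v (ltW uv).
  rewrite (le_trans (ler_norm v) vM) => /(_ _ isT).
  have -> : - M <= u by rewrite lerNl (le_trans _ uM)// -normrN ler_norm.
  move=> /(_ isT); apply/negP; rewrite -ltNge.
  apply: (@le_lt_trans _ _ 0%E); first by rewrite -uv0 gle.
  rewrite lte_fin mulr_gt0 ?subr_gt0// normal_pdfE// mulr_gt0 ?normal_peak_gt0 ?expR_gt0//.
have [z0 [z0M Hz0]] := dense_lipschitz_hit x c1_gt0 c2_gt0 c3_ge0 dS HF Sz1 z1K Fz1K.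
pose dl := e / (2 * c2).
have dl0 : 0 < dl by rewrite divr_gt0// mulr_gt0.
have dl1 : dl <= 1 by rewrite ler_pdivrMr ?mulr_gt0// mul1r; lra.
move: z0M; rewrite ler_norml => /andP[z0l z0u].
have h1 : z0 - dl <= z0 + dl by lra.
have h2 : - hit_bound <= z0 - dl by rewrite /hit_bound; lra.
have h3 : z0 + dl <= hit_bound by rewrite /hit_bound; lra.
have := gauss_itv_ge h1 h2 h3.
rewrite (_ : (_ - _) * _ = hit_const * e); last first.
  by rewrite /hit_const /dl; field; rewrite gt_eqF.
move=> h; apply: (le_trans h).
apply: le_trans (gle _ (measurable_itv _)) _.
apply: le_measure; rewrite ?inE.
- by apply: measurableI => //; exact: measurable_itv.
- by rewrite -[X in measurable X]setTI; apply: mF => //; exact: measurable_itv.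
move=> z [/=]; rewrite in_itv/= => /andP[zl zu] Sz.
have zd : `|z - z0| < dl by rewrite ltr_norml; apply/andP; split; lra.
have := Hz0 e z e0 Sz zd; rewrite ltr_norml in_itv/= => /andP[? ?].
by apply/andP; split; lra.
Qed.

End gauss_hit.

(** The bound of [gauss_hit] depends on w only through K. The sets [Good n] exhaust the complement
    of Bad, so one of them has positive measure, and K = n serves every w whose section of it is
    nonempty. Integrating over w leaves the measure of [Good n] as a factor. *)
Lemma prod_gauss_hit (R : realType) d (Om : measurableType d) (P : probability Om R)
    (F : Om * measurableTypeR R -> R) (Bad : set (Om * measurableTypeR R)) (c1 c2 c3 x : R) :
  0 < c1 -> 0 < c2 -> 0 <= c3 -> measurable_fun setT F -> measurable Bad ->
  (P \x @gauss R)%E Bad = 0%E ->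
  (forall w z z', ~ Bad (w, z) -> ~ Bad (w, z') -> z <= z' ->
     `|F (w, z') - F (w, z)| <= c2 * (z' - z) /\
     c1 * (z' - z) - c3 <= F (w, z') - F (w, z)) ->
  exists2 c, 0 < c & forall e, 0 < e < c2 ->
    ((c * e)%:E <= (P \x @gauss R)%E (F @^-1` `](x - e)%R, (x + e)%R[%classic))%E.
Proof.
move=> c10 c20 c30 mF mBad Bad0 HF.
pose Q : probability (Om * measurableTypeR R)%type R := (P \x @gauss R)%E.
pose Good n := ~` Bad `&` [set z | `|z.2 : R| <= n%:R] `&` [set z | `|F z| <= n%:R].
have mabs (f : Om * measurableTypeR R -> R) n :
    measurable_fun setT f -> measurable [set z | `|f z| <= n%:R].
  move=> mf; rewrite -[X in measurable X]setTI.
  rewrite (_ : [set z | _] = f @^-1` `[- n%:R, n%:R]%classic); first by apply: mf.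
  by apply/seteqP; split => z /=; rewrite in_itv/= ler_norml.
have mGood n : measurable (Good n).
  apply: measurableI; last exact: mabs.
  apply: measurableI; first exact: measurableC.
  exact: mabs.
have [n Qn] : exists n, Q (Good n) != 0%E.
  apply: contrapT => /forallNP Q0.
  have : Q setT = 0%E.
    rewrite -(setUv Bad) measureU ?setICr//; last exact: measurableC.
    rewrite [X in (X + _)%E]Bad0 add0e.
    have -> : ~` Bad = \bigcup_n Good n.
      apply/seteqP; split => [z nz|z [n _ [[]]]//].
      exists (Num.truncn (Num.max `|z.2 : R| `|F z|)).+1 => //.
      have h := ltW (truncnS_gt (Num.max `|z.2 : R| `|F z|)).
      by split; [split => //|] => /=; apply: le_trans h; rewrite le_max lexx ?orbT.
    apply/eqP; rewrite eq_le measure_ge0 andbT.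
    apply: (le_trans (measure_sigma_subadditive Q mGood
      (bigcup_measurable (fun k _ => mGood k)) (@subset_refl _ _))).
    rewrite eseries0// => i _ _.
    by have /negP := Q0 i; rewrite negbK => /eqP.
  by rewrite probability_setT => -[] /eqP; rewrite oner_eq0.
have Qfin : Q (Good n) \is a fin_num by apply: fin_num_measure.
exists (hit_const c1 c2 c3 n%:R x * fine (Q (Good n))).
  by rewrite mulr_gt0 ?hit_const_gt0// fine_gt0// lt0e Qn measure_ge0/= ltey_eq Qfin.
move=> e ec; have e0 : 0 <= e by case/andP: ec => /ltW.
have mI : measurable (F @^-1` `](x - e)%R, (x + e)%R[%classic).
  by rewrite -[X in measurable X]setTI; apply: mF.
rewrite mulrAC EFinM fineK//.
have hc0 := @hit_const_gt0 R c1 c2 c3 n%:R x c20.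
pose g := @gauss R.
(* Fubini: a null set of the product has null sections over almost every w. *)
have sec_ae : {ae P, forall w, g (xsection Bad w) = 0%E}.
  have mB : measurable_fun setT (g \o xsection Bad) by exact: (measurable_fun_xsection g).
  have := (ae_eq_integral_abs P measurableT mB).1.
  have -> : (\int[P]_w `|(g \o xsection Bad) w|)%E = 0%E.
    rewrite -[RHS]Bad0; apply: eq_integral => w _.
    by rewrite gee0_abs.
  by move=> /(_ erefl); apply: filterS => w /(_ I).
rewrite [Q _](_ : _ = \int[P]_w (g \o xsection (Good n)) w)%E//.
rewrite [leRHS](_ : _ = \int[P]_w (g \o xsection (F @^-1` `](x - e)%R, (x + e)%R[%classic)) w)%E//.
have mgs (A : set (Om * measurableTypeR R)) : measurable A -> measurable_fun setT (g \o xsection A).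
  by move=> mA; exact: (measurable_fun_xsection g).
rewrite -ge0_integralZl//; [|exact: mgs|by rewrite lee_fin mulr_ge0// ltW].
apply: ae_ge0_le_integral => //.
- by move=> w _; rewrite mule_ge0// lee_fin mulr_ge0// ltW.
- by apply: measurable_funeM; exact: mgs.
- exact: mgs.
apply: filterS sec_ae => w Bw _ /=.
have [[z Gz]|nG] := pselect (exists z, Good n (w, z)); last first.
  rewrite (_ : xsection (Good n) w = set0) ?measure0 ?mule0//.
  by apply/seteqP; split => // z; rewrite /xsection/= inE => Gz; apply: nG; exists z.
apply: (@le_trans _ _ (hit_const c1 c2 c3 n%:R x * e)%:E).
  have hep : 0 < hit_const c1 c2 c3 n%:R x * e by case/andP: ec => ? _; exact: mulr_gt0.
  rewrite -[leRHS]mule1 lee_pmul2l ?lte_fin ?probability_le1//.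
  exact: measurable_xsection (mGood n).
have xsE A z' : xsection A w z' = A (w, z').
  by apply/propext; rewrite /xsection/= inE.
have -> : xsection (F @^-1` `](x - e)%R, (x + e)%R[%classic) w =
    (fun z => F (w, z)) @^-1` `](x - e)%R, (x + e)%R[%classic.
  by apply/seteqP; split => z'; rewrite xsE.
apply: (@gauss_hit R c1 c2 c3 n%:R x c10 c20 c30 (~` xsection Bad w) (fun z => F (w, z))) => //.
- apply: measurableC; exact: measurable_xsection.
- by rewrite setCK.
- exact: measurableT_comp mF (pair1_measurable _).
- by move=> z1 z2; rewrite /setC/= !xsE; exact: HF.
- by exists z; case: Gz => -[nB zn] Fn; split => //; rewrite /setC/= xsE.
Qed.

Theorem corollary3p13 (R : realType) (H T r : R)
    (H_range : 2^-1 < H < 1) (T_gt0 : 0 < T) (r_gt0 : 0 < r)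
    (sigma b eta : R -> R)
    (sigma_smooth : smooth_bounded_on setT sigma)
    (b_smooth : smooth_bounded_on setT b)
    (eta_smooth : smooth_bounded_on `]- r, 0[%classic eta)
    (eta_cont : {within `[- r, 0], continuous eta})
    (lam Lam : R) (lam_gt0 : 0 < lam) (lam_lt_Lam : lam < Lam)
    (sigma_bounds : forall y : R, lam <= sigma y <= Lam)
    (P : probability (path_space T) R)
    (B_fbm : is_fbm P H T (@canonical_process R T))
    (X : R -> {RV P >-> R})
    (X_sol : {ae P, forall w : path_space T,
       delay_solution r T sigma b eta
         (fun t => canonical_process t w) (fun t => X t w)})
    (t : R) (t_range : 0 < t <= T)
    (p : R -> R) (p_density : is_smooth_density (X t) p) :
  forall x : R, closed_support p x -> 0 < p x.
Proof.
move=> x _.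
have [B [beta [B0 beta0 b_cont b_bound b_lip]]] := smooth_bounded_lipschitz b_smooth.
have [t0 tT] := andP t_range.
pose a := Num.max 0 (t - r).
have a0 : 0 <= a by rewrite le_max lexx.
have a_t : a < t by rewrite gt_max t0 gtrBl.
have tra : t - r <= a by rewrite le_max lexx orbT.
pose h := direction H a T.
have h_le0 s : s <= a -> h s = 0 by exact: direction_le0.
have ht : 0 < h t by exact: direction_gt0.
have C0_gt0 : 0 < (T - a) * mvn_const H.
  by rewrite mulr_gt0 ?mvn_const_gt0// subr_gt0 (lt_le_trans a_t).
have h_rkhs c : all (fun y : R * R => 0 <= y.2 <= T) c ->
    comb_eval h c ^+ 2 <= (T - a) * mvn_const H * fbm_ip H c c.
  move=> cT; apply: (direction_rkhs H_range a0 a_t tT).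
  by apply/allP => y /(allP cT) /andP[].
have t_itv : 0 <= t <= T by rewrite ltW.
have [N [k [Phi [k0 mPhi PhiE PhiP]]]] := fbm_shift_law (ltW T_gt0) B_fbm C0_gt0 h_rkhs
  t_itv (lt0r_neq0 ht) (continuous_direction H_range a0 a_t tT) (h_le0 0 a0).
have [M [mM PM subM]] := X_sol.
have solE z : ~ (Phi @^-1` M) z -> delay_solution r T sigma b eta
    (fun s => canonical_process s (Phi z)) (fun s => X s (Phi z)).
  by move=> nM; apply: contrapT => nS; apply: nM; exact: subM.
pose l := k * h t; have l0 : 0 < l by exact: mulr_gt0.
have Lam_gt0 : 0 < Lam := lt_trans lam_gt0 lam_lt_Lam.
(* The Gronwall constant of [delay_flow] for the perturbation (z' - z) k h; the lower slope is
   [lam * l] and the loss [2 * B * t] comes from the drift. *)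
pose c2 := 2 * (Lam * l) * expR (2 * beta * t).
have c20 : 0 < c2 by rewrite !mulr_gt0 ?expR_gt0.
have HF w z z' : ~ (Phi @^-1` M) (w, z) -> ~ (Phi @^-1` M) (w, z') -> z <= z' ->
    `|X t (Phi (w, z')) - X t (Phi (w, z))| <= c2 * (z' - z) /\
    lam * l * (z' - z) - 2 * B * t <= X t (Phi (w, z')) - X t (Phi (w, z)).
  move=> nz nz' zz'; have dz0 : 0 <= z' - z by rewrite subr_ge0.
  have wE u : 0 <= u <= T -> canonical_process u (Phi (w, z')) =
      canonical_process u (Phi (w, z)) + (z' - z) * (k * h u).
    by move=> uT; rewrite !PhiE//=; ring.
  have kh0 : k * h 0 = 0 by rewrite h_le0// mulr0.
  have [|s s' _ ss' _|D1 D2] := delay_flow r_gt0 sigma_bounds (ltW lam_gt0) b_bound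
    b_lip beta0 b_cont (solE _ nz) (solE _ nz') dz0 wE kh0 t_itv a0 (ltW a_t) tra.
  - by move=> s /andP[_ sa]; rewrite h_le0// mulr0.
  - by rewrite ler_pM2l// le_direction.
  split.
    by move: D1; rewrite /c2 /l; congr (_ <= _); ring.
  by move: D2; rewrite /l; congr (_ <= _); ring.
(* The bad set is the preimage of the null set off which X solves the equation; it is null because
   Phi preserves the law. *)
have [|||||c c0 Hc] := @prod_gauss_hit R _ _ P (X t \o Phi) (Phi @^-1` M)
  (lam * l) c2 (2 * B * t) x _ c20 _ _ _ _ HF.
- exact: mulr_gt0.
- by rewrite !mulr_ge0// ltW.
- exact: measurableT_comp.
- by rewrite -[X in measurable X]setTI; exact: mPhi.
- by rewrite PhiP.
apply: (density_gt0 p_density c0 c20) => e ec.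
rewrite -PhiP; first exact: Hc.
by rewrite -[X in measurable X]setTI; exact: measurable_funP.
Qed.
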